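(* $\mathbf{ACA}_0$ proves that for every sequence $(K_i)_{i\in\mathbb{N}}$ of compact $T_2$ CSC spaces, the disjoint sum $\coprod_{i\in\mathbb{N}}K_i$ is homeomorphic to a well-order with the order topology or the upper limit topology.
   Context: All notions are formalized in second order arithmetic. CSC space: a tuple $(X,(U_i)_{i\in\mathbb{N}},k)$ with $X\subseteq\mathbb{N}$, $(U_i)$ a sequence of subsets of $X$ such that every $x\in X$ lies in some $U_i$, and $k:X\times\mathbb{N}\times\mathbb{N}\to\mathbb{N}$ a partial function such that $x\in U_i\cap U_j$ implies $x\in U_{k(x,i,j)}\subseteq U_i\cap U_j$. A set $A\subseteq X$ is open if for all $x\in A$ there is $i$ with $x\in U_i\subseteq A$. $X$ is $T_2$ if any distinct $x,y$ lie in disjoint basic open sets $U_i\ni x$, $U_j\ni y$. $X$ is compact if for every $I\subseteq\mathbb{N}$ with $X=\bigcup_{i\in I}U_i$ there is a finite $a\subseteq I$ with $X=\bigcup_{i\in a}U_i$. Disjoint sum of a sequence $(X^j,(U^j_i)_{i},k^j)_{j\in\mathbb{N}}$ of CSC spaces: the point set is $\coprod_j X^j=\{(j,x):x\in X^j\}$, the basic open sets are $\{j\}\times U_i^j$ for $i,j\in\mathbb{N}$, with the intersection function induced by the $k^j$. Order topology on a linear order $L$: basic open sets are $]a,b[$ with $a,b\in L\cup\{-\infty,+\infty\}$. Upper limit topology: the sets $]a,b]$ with $a,b\in L$ are added to this basis. Over $\mathbf{ACA}_0$ the identity map is a homeomorphism between these two topologies on any well-order. Over $\mathbf{ACA}_0$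 homeomorphisms are not distinguished from effective homeomorphisms (those whose pointwise continuity, in both directions, is witnessed by a function choosing indices of basic neighbourhoods). *)

(* Defs.v *)
From Stdlib Require Import List.

Set Implicit Arguments.
Unset Strict Implicit.
Unset Printing Implicit Defensive.

(** * The language of second order arithmetic *)

(* De Bruijn indices, with separate numberings for number variables and for
   set variables.  The only set terms are set variables, and there is no
   primitive equality between sets. *)
Inductive term : Type :=
| Var (n : nat)
| TZero
| TOne
| Plus (s t : term)
| Times (s t : term).

Inductive form : Type :=
| Equal (s t : term)
| Less (s t : term)
| Mem (t : term) (X : nat)
| Bot
| Imp (A B : form)
| ForallN (A : form)
| ForallS (A : form).

Definition Not (A : form) : form := Imp A Bot.
Definition And (A B : form) : form := Not (Imp A (Not B)).
Definition Or (A B : form) : form := Imp (Not A) B.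
Definition Iff (A B : form) : form := And (Imp A B) (Imp B A).
Definition ExistsN (A : form) : form := Not (ForallN (Not A)).
Definition ExistsS (A : form) : form := Not (ForallS (Not A)).

(** Simultaneous substitution of terms for number variables and of set
    variables for set variables. *)

Fixpoint tsubst (f : nat -> term) (t : term) : term :=
  match t with
  | Var n => f n
  | TZero => TZero
  | TOne => TOne
  | Plus s t => Plus (tsubst f s) (tsubst f t)
  | Times s t => Times (tsubst f s) (tsubst f t)
  end.

Definition upN (f : nat -> term) (n : nat) : term :=
  match n with
  | O => Var O
  | S m => tsubst (fun p => Var (S p)) (f m)
  end.

Definition upS (g : nat -> nat) (n : nat) : nat :=
  match n with
  | O => O
  | S m => S (g m)
  end.

Fixpoint subst (f : nat -> term) (g : nat -> nat) (A : form) : form :=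
  match A with
  | Equal s t => Equal (tsubst f s) (tsubst f t)
  | Less s t => Less (tsubst f s) (tsubst f t)
  | Mem t X => Mem (tsubst f t) (g X)
  | Bot => Bot
  | Imp A B => Imp (subst f g A) (subst f g B)
  | ForallN A => ForallN (subst (upN f) g A)
  | ForallS A => ForallS (subst f (upS g) A)
  end.

Definition shiftN : form -> form := subst (fun n => Var (S n)) (fun X => X).
Definition shiftS : form -> form := subst Var S.

Definition instN (t : term) : form -> form :=
  subst (fun n => match n with O => t | S m => Var m end) (fun X => X).
Definition instS (Y : nat) : form -> form :=
  subst Var (fun X => match X with O => Y | S Z => Z end).

(** * Derivability *)

(* Two-sorted classical natural deduction with equality on numbers.  Axioms of
   [T] stand for their universal closures: unlike the hypotheses in [H], they
   are not shifted by the generalization rules. *)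
Inductive prv (T : form -> Prop) : list form -> form -> Prop :=
| prv_ax H A : T A -> prv T H A
| prv_hyp H A : List.In A H -> prv T H A
| prv_impI H A B : prv T (A :: H) B -> prv T H (Imp A B)
| prv_impE H A B : prv T H (Imp A B) -> prv T H A -> prv T H B
| prv_raa H A : prv T (Not A :: H) Bot -> prv T H A
| prv_allNI H A : prv T (map shiftN H) A -> prv T H (ForallN A)
| prv_allNE H A t : prv T H (ForallN A) -> prv T H (instN t A)
| prv_allSI H A : prv T (map shiftS H) A -> prv T H (ForallS A)
| prv_allSE H A Y : prv T H (ForallS A) -> prv T H (instS Y A)
| prv_refl H t : prv T H (Equal t t)
| prv_eq H A s t : prv T H (Equal s t) -> prv T H (instN s A) -> prv T H (instN t A).

(** * Formulas with named binders *)

(* To write formulas without explicit indices, an expression is represented as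
   a function of the numbers of number and set quantifiers above it; a variable
   bound below [d] quantifiers of its sort occurs at depth [d'] as the index
   [d' - S d]. *)
Definition tm := nat -> term.
Definition sv := nat -> nat.
Definition fm := nat -> nat -> form.

Declare Scope tm_scope.
Declare Scope fm_scope.
Delimit Scope tm_scope with tm.
Delimit Scope fm_scope with fm.
Bind Scope tm_scope with tm.
Bind Scope fm_scope with fm.

Definition zero : tm := fun _ => TZero.
Definition one : tm := fun _ => TOne.
Definition addT (s t : tm) : tm := fun d => Plus (s d) (t d).
Definition mulT (s t : tm) : tm := fun d => Times (s d) (t d).

Definition eqF (s t : tm) : fm := fun d _ => Equal (s d) (t d).
Definition ltF (s t : tm) : fm := fun d _ => Less (s d) (t d).
Definition memF (t : tm) (X : sv) : fm := fun d e => Mem (t d) (X e).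
Definition notF (A : fm) : fm := fun d e => Not (A d e).
Definition impF (A B : fm) : fm := fun d e => Imp (A d e) (B d e).
Definition andF (A B : fm) : fm := fun d e => And (A d e) (B d e).
Definition orF (A B : fm) : fm := fun d e => Or (A d e) (B d e).
Definition iffF (A B : fm) : fm := fun d e => Iff (A d e) (B d e).
Definition allN (F : tm -> fm) : fm :=
  fun d e => ForallN (F (fun d' => Var (d' - S d)) (S d) e).
Definition exN (F : tm -> fm) : fm :=
  fun d e => ExistsN (F (fun d' => Var (d' - S d)) (S d) e).
Definition allS (F : sv -> fm) : fm :=
  fun d e => ForallS (F (fun e' => e' - S e) d (S e)).
Definition exS (F : sv -> fm) : fm :=
  fun d e => ExistsS (F (fun e' => e' - S e) d (S e)).

Notation "0" := zero : tm_scope.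
Notation "1" := one : tm_scope.
Notation "s + t" := (addT s t) : tm_scope.
Notation "s * t" := (mulT s t) : tm_scope.

Notation "s = t" := (eqF s t) : fm_scope.
Notation "s < t" := (ltF s t) : fm_scope.
Notation "t ∈ X" := (memF t X) (at level 70) : fm_scope.
Notation "¬ A" := (notF A) (at level 75, right associativity) : fm_scope.
Notation "A ∧ B" := (andF A B) (at level 80, right associativity) : fm_scope.
Notation "A ∨ B" := (orF A B) (at level 85, right associativity) : fm_scope.
Notation "A ⇒ B" := (impF A B) (at level 99, B at level 200, right associativity) : fm_scope.
Notation "A ⇔ B" := (iffF A B) (at level 95, no associativity) : fm_scope.
(* Quantification over numbers. *)
Notation "∀ x .. y , A" := (allN (fun x => .. (allN (fun y => A%fm)) ..))
  (at level 200, x binder, y binder, right associativity) : fm_scope.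
Notation "∃ x .. y , A" := (exN (fun x => .. (exN (fun y => A%fm)) ..))
  (at level 200, x binder, y binder, right associativity) : fm_scope.
(* Quantification over sets. *)
Notation "∀² X .. Y , A" := (allS (fun X => .. (allS (fun Y => A%fm)) ..))
  (at level 200, X binder, Y binder, right associativity) : fm_scope.
Notation "∃² X .. Y , A" := (exS (fun X => .. (exS (fun Y => A%fm)) ..))
  (at level 200, X binder, Y binder, right associativity) : fm_scope.

Definition proves (T : form -> Prop) (A : fm) : Prop := prv T nil (A 0 0).
Notation "T ⊢ A" := (proves T A%fm) (at level 190, A at level 200, no associativity).

Local Open Scope tm_scope.
Local Open Scope fm_scope.

(** * The theory ACA_0 *)

Fixpoint arithmetical (A : form) : Prop :=
  match A with
  | Equal _ _ | Less _ _ | Mem _ _ | Bot => True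
  | Imp A B => arithmetical A /\ arithmetical B
  | ForallN A => arithmetical A
  | ForallS _ => False
  end.

Definition basic_axioms : list fm :=
  (∀ n, ¬ (n + 1 = 0)) ::
  (∀ m n, m + 1 = n + 1 ⇒ m = n) ::
  (∀ m, m + 0 = m) ::
  (∀ m n, m + (n + 1) = (m + n) + 1) ::
  (∀ m, m * 0 = 0) ::
  (∀ m n, m * (n + 1) = m * n + m) ::
  (∀ m, ¬ (m < 0)) ::
  (∀ m n, m < n + 1 ⇔ (m < n ∨ m = n)) :: nil.

Definition induction_axiom : fm :=
  ∀² X, 0 ∈ X ∧ (∀ n, n ∈ X ⇒ n + 1 ∈ X) ⇒ ∀ n, n ∈ X.

(* "There is X such that for all n, n is in X iff A(n)", where n is the number
   variable 0 of [A] and the other variables of [A] are parameters. *)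
Definition comprehension (A : form) : form :=
  ExistsS (ForallN (Iff (Mem (Var 0) 0) (shiftS A))).

Inductive ACA0 : form -> Prop :=
| ACA0_basic (A : fm) : List.In A basic_axioms -> ACA0 (A O O)
| ACA0_induction : ACA0 (induction_axiom O O)
| ACA0_comprehension (A : form) : arithmetical A -> ACA0 (comprehension A).

(** * CSC spaces *)

(* The usual injective (not surjective) pairing of numbers. *)
Definition pairT (s t : tm) : tm := (s + t) * (s + t) + s.
Notation "⟨ s , t ⟩" := (pairT s t) (at level 0, s at level 99, t at level 99) : tm_scope.

(* A space given by the membership conditions of its coding sets: [pts x] says
   that x is a point, [bas i x] that x is in U_i, and [int x i j m] that
   k(x,i,j) is defined with value m.  All the conditions used below are
   arithmetical in set variables, hence define sets in ACA_0. *)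
Record space : Type := Space {
  pts : tm -> fm;
  bas : tm -> tm -> fm;
  int : tm -> tm -> tm -> tm -> fm }.

Definition CSC (S : space) : fm :=
  (∀ i x, bas S i x ⇒ pts S x) ∧
  (∀ x, pts S x ⇒ ∃ i, bas S i x) ∧
  (∀ x i j m, int S x i j m ⇒ pts S x) ∧
  (∀ x i j m n, int S x i j m ∧ int S x i j n ⇒ m = n) ∧
  (∀ x i j, bas S i x ∧ bas S j x ⇒
     ∃ m, int S x i j m ∧ bas S m x ∧
          ∀ y, bas S m y ⇒ bas S i y ∧ bas S j y).

Definition T2 (S : space) : fm :=
  ∀ x y, pts S x ∧ pts S y ∧ ¬ (x = y) ⇒
    ∃ i j, bas S i x ∧ bas S j y ∧ ¬ (∃ z, bas S i z ∧ bas S j z).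

Definition finite (A : sv) : fm := ∃ n, ∀ i, i ∈ A ⇒ i < n.

Definition covers (S : space) (I : sv) : fm :=
  ∀ x, pts S x ⇔ ∃ i, i ∈ I ∧ bas S i x.

Definition compact (S : space) : fm :=
  ∀² I, covers S I ⇒
    ∃² A, finite A ∧ (∀ i, i ∈ A ⇒ i ∈ I) ∧ covers S A.

(* [f] is the graph of a function on the points of [S] with values in the
   points of [S']. *)
Definition function (S S' : space) (f : sv) : fm :=
  (∀ z, z ∈ f ⇒ ∃ x y, z = ⟨x, y⟩ ∧ pts S x ∧ pts S' y) ∧
  (∀ x, pts S x ⇒ ∃ y, ⟨x, y⟩ ∈ f) ∧
  (∀ x y y', ⟨x, y⟩ ∈ f ∧ ⟨x, y'⟩ ∈ f ⇒ y = y').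

Definition bijective (S S' : space) (f : sv) : fm :=
  (∀ x x' y, ⟨x, y⟩ ∈ f ∧ ⟨x', y⟩ ∈ f ⇒ x = x') ∧
  (∀ y, pts S' y ⇒ ∃ x, ⟨x, y⟩ ∈ f).

Definition continuous (S S' : space) (f : sv) : fm :=
  ∀ x y j, ⟨x, y⟩ ∈ f ∧ bas S' j y ⇒
    ∃ i, bas S i x ∧
         ∀ x' y', bas S i x' ∧ ⟨x', y'⟩ ∈ f ⇒ bas S' j y'.

Definition continuous_inverse (S S' : space) (f : sv) : fm :=
  ∀ x y i, ⟨x, y⟩ ∈ f ∧ bas S i x ⇒
    ∃ j, bas S' j y ∧
         ∀ x' y', bas S' j y' ∧ ⟨x', y'⟩ ∈ f ⇒ bas S i x'.

Definition homeomorphic (S S' : space) : fm :=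
  ∃² f, function S S' f ∧ bijective S S' f ∧
        continuous S S' f ∧ continuous_inverse S S' f.

(** * Sequences of spaces and their disjoint sum *)

(* The [j]-th space of the sequence coded by the sets [X], [U] and [k]. *)
Definition nth_space (X U k : sv) (j : tm) : space := {|
  pts := fun x => ⟨j, x⟩ ∈ X;
  bas := fun i x => ⟨j, ⟨i, x⟩⟩ ∈ U;
  int := fun x i i' m => ⟨j, ⟨⟨x, ⟨i, i'⟩⟩, m⟩⟩ ∈ k |}.

(* The basic open set {j} × U_i^j has index ⟨j, i⟩; numbers which are not pairs
   index the empty set. *)
Definition disjoint_sum (K : tm -> space) : space := {|
  pts := fun z => ∃ j x, z = ⟨j, x⟩ ∧ pts (K j) x;
  bas := fun p z => ∃ j i x, p = ⟨j, i⟩ ∧ z = ⟨j, x⟩ ∧ bas (K j) i x;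
  int := fun z p q r => ∃ j x i i' m,
           z = ⟨j, x⟩ ∧ p = ⟨j, i⟩ ∧ q = ⟨j, i'⟩ ∧ r = ⟨j, m⟩ ∧
           int (K j) x i i' m |}.

(** * Well-orders and their topologies *)

(* [R] is a strict linear order on the set [L]. *)
Definition linear_order (L R : sv) : fm :=
  (∀ z, z ∈ R ⇒ ∃ x y, z = ⟨x, y⟩ ∧ x ∈ L ∧ y ∈ L) ∧
  (∀ x, ¬ (⟨x, x⟩ ∈ R)) ∧
  (∀ x y z, ⟨x, y⟩ ∈ R ∧ ⟨y, z⟩ ∈ R ⇒ ⟨x, z⟩ ∈ R) ∧
  (∀ x y, x ∈ L ∧ y ∈ L ⇒ ⟨x, y⟩ ∈ R ∨ x = y ∨ ⟨y, x⟩ ∈ R).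

Definition sequence_in (L f : sv) : fm :=
  (∀ z, z ∈ f ⇒ ∃ n x, z = ⟨n, x⟩ ∧ x ∈ L) ∧
  (∀ n, ∃ x, ⟨n, x⟩ ∈ f) ∧
  (∀ n x y, ⟨n, x⟩ ∈ f ∧ ⟨n, y⟩ ∈ f ⇒ x = y).

Definition well_order (L R : sv) : fm :=
  linear_order L R ∧
  ¬ (∃² f, sequence_in L f ∧
           ∀ n x y, ⟨n, x⟩ ∈ f ∧ ⟨n + 1, y⟩ ∈ f ⇒ ⟨y, x⟩ ∈ R).

(* Endpoints are coded by numbers: 0 is the infinite endpoint, and a + 1 is the
   element a. *)
Definition above_left (R : sv) (a x : tm) : fm :=
  a = 0 ∨ ∃ u, a = u + 1 ∧ ⟨u, x⟩ ∈ R.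
Definition below_right (R : sv) (b x : tm) : fm :=
  b = 0 ∨ ∃ v, b = v + 1 ∧ ⟨x, v⟩ ∈ R.

(* x is in the open interval of index i. *)
Definition open_interval (L R : sv) (i x : tm) : fm :=
  ∃ a b, i = ⟨a, b⟩ ∧ x ∈ L ∧ above_left R a x ∧ below_right R b x.

Definition upper_closed_interval (L R : sv) (i x : tm) : fm :=
  ∃ a b, i = ⟨a, b⟩ ∧ a ∈ L ∧ b ∈ L ∧ ⟨a, x⟩ ∈ R ∧ (⟨x, b⟩ ∈ R ∨ x = b).

Definition order_topology (L R k : sv) : space := {|
  pts := fun x => x ∈ L;
  bas := open_interval L R;
  int := fun x i j m => ⟨⟨x, ⟨i, j⟩⟩, m⟩ ∈ k |}.

Definition upper_limit_topology (L R k : sv) : space := {|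
  pts := fun x => x ∈ L;
  bas := fun p x => ∃ i, (p = ⟨0, i⟩ ∧ open_interval L R i x) ∨
                         (p = ⟨1, i⟩ ∧ upper_closed_interval L R i x);
  int := fun x i j m => ⟨⟨x, ⟨i, j⟩⟩, m⟩ ∈ k |}.

(* Main.v *)
(** By the completeness theorem for [prv] it suffices to argue in an arbitrary,
    possibly nonstandard, Henkin model of ACA_0.  A compact T2 space whose points
    are numbers has its points separated by clopen sets: two basic sets with
    disjoint closures are enlarged point by point, each point going with its
    first admissible neighbourhood to one of the two sides, and the recursion is
    carried out on finite sets coded by Goedel's beta function.  Compactness
    makes every clopen set a finite union of basic sets, so all clopen sets are
    enumerated by codes, and the first n of them cut the space into pieces of
    level n.  Order the points lexicographically along this tree of partitions,
    always placing the half that contains the numerically least point of the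
    piece on the right.  The least point of a piece is then its last element.
    For a nonempty set, the leftmost branch of pieces meeting it converges by
    compactness to a point, which is eventually the last element of its pieces,
    and so it is the minimum of the set.  Every piece is convex, and what lies
    to its left, if anything, has a last element.  Hence pieces are neighbourhoods
    in the order topology.  The disjoint sum is ordered lexicographically, and
    the homeomorphism is the identity. *)

From Stdlib Require Import List Arith Lia Cantor Ring.
From Stdlib Require Import Classical ClassicalEpsilon FunctionalExtensionality PropExtensionality ProofIrrelevance.
Require Import Defs.

Set Implicit Arguments.

(** * Substitution *)

(** Definability is the obstacle. In a model, induction, least elements and compactness are at hand
    for arithmetical predicates only, and comprehension cannot be iterated along the numbers. So the
    separation is computed from finite histories in which each step answers an arithmetical
    question, and every predicate put under an induction is certified by the tactic [arith], which
    follows its syntax. The numbering of the points is used twice. It schedules the separation: the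
    point v is placed at step v. And it chooses the right half: the numerically least point of a
    piece stays least in every smaller piece around it, so last elements are stable, and each point
    becomes least in its piece at some level, since it has only to be separated from the numbers
    below it. The three topologies are never compared directly: each basis is shown to have the
    pieces as neighbourhoods, which settles the order and the upper limit topology at once. *)

Lemma tsubst_comp f f' t :
  tsubst f' (tsubst f t) = tsubst (fun n => tsubst f' (f n)) t.
Proof. induction t; cbn; congruence. Qed.

Lemma tsubst_id t : tsubst Var t = t.
Proof. induction t; cbn; congruence. Qed.

Lemma upN_comp f f' :
  (fun n => tsubst (upN f') (upN f n)) = upN (fun n => tsubst f' (f n)).
Proof.
  apply functional_extensionality; intros [|n]; cbn; auto.
  rewrite !tsubst_comp; reflexivity.
Qed.

Lemma upS_comp g g' : (fun n => upS g' (upS g n)) = upS (fun n => g' (g n)).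
Proof. apply functional_extensionality; intros [|n]; reflexivity. Qed.

Lemma subst_comp A : forall f g f' g',
  subst f' g' (subst f g A) = subst (fun n => tsubst f' (f n)) (fun X => g' (g X)) A.
Proof.
  induction A; intros; cbn; rewrite ?tsubst_comp; try congruence.
  - rewrite IHA1, IHA2; reflexivity.
  - rewrite IHA, upN_comp; reflexivity.
  - rewrite IHA, upS_comp; reflexivity.
Qed.

Lemma subst_id A : subst Var (fun X => X) A = A.
Proof.
  induction A; cbn; rewrite ?tsubst_id; try congruence.
  - replace (upN Var) with Var; [congruence|].
    apply functional_extensionality; intros [|n]; reflexivity.
  - replace (upS (fun X => X)) with (fun X : nat => X); [congruence|].
    apply functional_extensionality; intros [|n]; reflexivity.
Qed.

Definition consN {D : Type} (t : D) (f : nat -> D) (n : nat) : D :=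
  match n with O => t | S m => f m end.

Lemma subst_shiftN f g A : subst (upN f) g (shiftN A) = shiftN (subst f g A).
Proof. unfold shiftN; rewrite !subst_comp; reflexivity. Qed.

Lemma subst_shiftS f g A : subst f (upS g) (shiftS A) = shiftS (subst f g A).
Proof.
  unfold shiftS; rewrite !subst_comp; f_equal.
  apply functional_extensionality; intros n; cbn; now rewrite tsubst_id.
Qed.

Lemma instN_up t f g A : instN t (subst (upN f) g A) = subst (consN t f) g A.
Proof.
  unfold instN; rewrite subst_comp; f_equal.
  apply functional_extensionality; intros [|n]; cbn; auto.
  rewrite tsubst_comp; apply tsubst_id.
Qed.

Lemma instS_up Y f g A : instS Y (subst f (upS g) A) = subst f (consN Y g) A.
Proof.
  unfold instS; rewrite subst_comp; f_equal; apply functional_extensionality.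
  - intros n; apply tsubst_id.
  - intros [|n]; reflexivity.
Qed.

Lemma subst_instN f g t A :
  subst f g (instN t A) = instN (tsubst f t) (subst (upN f) g A).
Proof.
  rewrite instN_up; unfold instN; rewrite subst_comp; f_equal.
  apply functional_extensionality; intros [|n]; reflexivity.
Qed.

Lemma subst_instS f g Y A : subst f g (instS Y A) = instS (g Y) (subst f (upS g) A).
Proof.
  rewrite instS_up; unfold instS; rewrite subst_comp; f_equal.
  apply functional_extensionality; intros [|n]; reflexivity.
Qed.

Fixpoint tbound (t : term) : nat :=
  match t with
  | Var n => S n
  | TZero | TOne => 0
  | Plus s t | Times s t => Nat.max (tbound s) (tbound t)
  end.

Fixpoint boundN (A : form) : nat :=
  match A with
  | Equal s t | Less s t => Nat.max (tbound s) (tbound t)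
  | Mem t _ => tbound t
  | Bot => 0
  | Imp A B => Nat.max (boundN A) (boundN B)
  | ForallN A | ForallS A => boundN A
  end.

Fixpoint boundS (A : form) : nat :=
  match A with
  | Mem _ X => S X
  | Equal _ _ | Less _ _ | Bot => 0
  | Imp A B => Nat.max (boundS A) (boundS B)
  | ForallN A | ForallS A => boundS A
  end.

Lemma tsubst_bound f f' t :
  (forall n, n < tbound t -> f n = f' n) -> tsubst f t = tsubst f' t.
Proof.
  induction t; cbn; intros E; auto;
    rewrite IHt1, IHt2; auto; intros; apply E; lia.
Qed.

Lemma subst_bound A : forall f f' g g',
  (forall n, n < boundN A -> f n = f' n) -> (forall X, X < boundS A -> g X = g' X) ->
  subst f g A = subst f' g' A.
Proof.
  induction A; cbn; intros f f' g g' E F; auto.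
  - rewrite !(tsubst_bound f f'); auto; intros; apply E; lia.
  - rewrite !(tsubst_bound f f'); auto; intros; apply E; lia.
  - rewrite (tsubst_bound f f'), F; auto; intros; apply E; lia.
  - rewrite (IHA1 f f' g g'), (IHA2 f f' g g'); auto; intros;
      first [apply E | apply F]; lia.
  - rewrite (IHA (upN f) (upN f') g g'); auto.
    intros [|n] Hn; cbn; auto. rewrite E; auto; lia.
  - rewrite (IHA f f' (upS g) (upS g')); auto.
    intros [|n] Hn; cbn; auto. rewrite F; auto; lia.
Qed.

(** * Derived rules *)

(** Axioms are not shifted by the generalization rules, so a derivation can be renamed only if the
    axioms are stable under substitution. The same property makes the term model satisfy the axioms
    under every assignment. *)
Definition subst_closed (T : form -> Prop) : Prop :=
  forall f g A, T A -> T (subst f g A).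

Lemma prv_subst T H A : subst_closed T -> prv T H A ->
  forall f g, prv T (map (subst f g) H) (subst f g A).
Proof.
  intros HT; induction 1; intros f g; cbn in *.
  - apply prv_ax; auto.
  - apply prv_hyp; apply in_map; auto.
  - apply prv_impI; apply IHprv.
  - eapply prv_impE; [apply IHprv1 | apply IHprv2].
  - apply prv_raa; apply IHprv.
  - apply prv_allNI. specialize (IHprv (upN f) g).
    rewrite map_map in *; erewrite map_ext; [exact IHprv|].
    intros B; cbn; symmetry; apply subst_shiftN.
  - rewrite subst_instN; apply prv_allNE; apply IHprv.
  - apply prv_allSI. specialize (IHprv f (upS g)).
    rewrite map_map in *; erewrite map_ext; [exact IHprv|].
    intros B; cbn; symmetry; apply subst_shiftS.
  - rewrite subst_instS; apply prv_allSE; apply IHprv.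
  - apply prv_refl.
  - rewrite subst_instN. eapply prv_eq; [apply IHprv1|].
    rewrite <- subst_instN; apply IHprv2.
Qed.

Lemma prv_weaken T H A : prv T H A -> forall H', incl H H' -> prv T H' A.
Proof.
  induction 1; intros H' I.
  - apply prv_ax; auto.
  - apply prv_hyp; auto.
  - apply prv_impI; apply IHprv; intros C [<-|HC]; [left | right]; auto.
  - eapply prv_impE; auto.
  - apply prv_raa; apply IHprv; intros C [<-|HC]; [left | right]; auto.
  - apply prv_allNI; apply IHprv; apply incl_map; auto.
  - apply prv_allNE; auto.
  - apply prv_allSI; apply IHprv; apply incl_map; auto.
  - apply prv_allSE; auto.
  - apply prv_refl.
  - eapply prv_eq; auto.
Qed.

Lemma prv_cut T H A B : prv T H A -> prv T (A :: H) B -> prv T H B.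
Proof. intros HA HB; eapply prv_impE; [apply prv_impI; exact HB | exact HA]. Qed.

Lemma prv_exfalso T H A : prv T H Bot -> prv T H A.
Proof. intros HB; apply prv_raa; eapply prv_weaken; [exact HB | apply incl_tl, incl_refl]. Qed.

Lemma prv_gen_fresh T H B k : subst_closed T ->
  (forall C, In C H -> boundN C <= k) -> boundN B <= S k ->
  prv T H (instN (Var k) B) -> prv T H (ForallN B).
Proof.
  intros HT HH HB P; apply prv_allNI.
  (* The fresh variable [k] becomes the variable about to be bound and all others are shifted. On
     formulas that do not mention [k] this is [shiftN]. *)
  set (f := fun n => if n =? k then Var 0 else Var (S n)).
  apply (prv_subst HT) with (f := f) (g := fun X => X) in P.
  assert (Hf : forall n, n < k -> f n = Var (S n)).
  { intros n Hn; unfold f; destruct (Nat.eqb_spec n k); [lia | auto]. }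
  erewrite map_ext_in with (g := shiftN) in P.
  - enough (E : subst f (fun X => X) (instN (Var k) B) = B) by (rewrite E in P; exact P).
    rewrite <- (subst_id B) at 2. unfold instN. rewrite subst_comp.
    apply subst_bound; auto.
    intros [|n] Hn; cbn.
    + unfold f; now rewrite Nat.eqb_refl.
    + apply Hf; lia.
  - intros C HC. apply subst_bound; auto.
    intros n Hn; apply Hf; specialize (HH C HC); lia.
Qed.

Lemma prv_gen_freshS T H B k : subst_closed T ->
  (forall C, In C H -> boundS C <= k) -> boundS B <= S k ->
  prv T H (instS k B) -> prv T H (ForallS B).
Proof.
  intros HT HH HB P; apply prv_allSI.
  set (f := fun n => if n =? k then 0 else S n).
  apply (prv_subst HT) with (f := Var) (g := f) in P.
  assert (Hf : forall n, n < k -> f n = S n).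
  { intros n Hn; unfold f; destruct (Nat.eqb_spec n k); [lia | auto]. }
  erewrite map_ext_in with (g := shiftS) in P.
  - enough (E : subst Var f (instS k B) = B) by (rewrite E in P; exact P).
    rewrite <- (subst_id B) at 2. unfold instS. rewrite subst_comp.
    apply subst_bound; auto.
    intros [|n] Hn; cbn.
    + unfold f; now rewrite Nat.eqb_refl.
    + apply Hf; lia.
  - intros C HC. apply subst_bound; auto.
    intros n Hn; apply Hf; specialize (HH C HC); lia.
Qed.

(** * Henkin models *)

Record structure : Type := Structure {
  num : Type;
  sets : Type;
  mzero : num;
  mone : num;
  madd : num -> num -> num;
  mmul : num -> num -> num;
  mlt : num -> num -> Prop;
  mem : num -> sets -> Prop }.

Fixpoint eval (M : structure) (e : nat -> num M) (t : term) : num M :=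
  match t with
  | Var n => e n
  | TZero => mzero M
  | TOne => mone M
  | Plus s t => madd M (eval M e s) (eval M e t)
  | Times s t => mmul M (eval M e s) (eval M e t)
  end.

Fixpoint sat (M : structure) (e : nat -> num M) (s : nat -> sets M) (A : form) : Prop :=
  match A with
  | Equal t u => eval M e t = eval M e u
  | Less t u => mlt M (eval M e t) (eval M e u)
  | Mem t X => mem M (eval M e t) (s X)
  | Bot => False
  | Imp A B => sat M e s A -> sat M e s B
  | ForallN A => forall d, sat M (consN d e) s A
  | ForallS A => forall X, sat M e (consN X s) A
  end.

Definition model_of (T : form -> Prop) (M : structure) : Prop :=
  forall A e s, T A -> sat M e s A.

(** * Completeness *)

Fixpoint tcode (t : term) : nat :=
  match t with
  | Var n => to_nat (0, n)
  | TZero => to_nat (1, 0)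
  | TOne => to_nat (2, 0)
  | Plus s t => to_nat (3, to_nat (tcode s, tcode t))
  | Times s t => to_nat (4, to_nat (tcode s, tcode t))
  end.

Fixpoint code (A : form) : nat :=
  match A with
  | Equal s t => to_nat (0, to_nat (tcode s, tcode t))
  | Less s t => to_nat (1, to_nat (tcode s, tcode t))
  | Mem t X => to_nat (2, to_nat (tcode t, X))
  | Bot => to_nat (3, 0)
  | Imp A B => to_nat (4, to_nat (code A, code B))
  | ForallN A => to_nat (5, code A)
  | ForallS A => to_nat (6, code A)
  end.

Lemma to_nat_inj p q : to_nat p = to_nat q -> p = q.
Proof. intros E; rewrite <- (cancel_of_to p), E; apply cancel_of_to. Qed.

Ltac code_inj :=
  repeat match goal with
  | H : to_nat _ = to_nat _ |- _ => apply to_nat_inj, pair_equal_spec in H; destruct H; try discriminate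
  end.

Lemma tcode_inj t : forall t', tcode t = tcode t' -> t = t'.
Proof. induction t; intros []; cbn -[to_nat]; intros; code_inj; f_equal; auto. Qed.

Lemma code_inj A : forall A', code A = code A' -> A = A'.
Proof.
  induction A; intros []; cbn -[to_nat]; intros; code_inj; f_equal; auto using tcode_inj.
Qed.

Section Henkin.
Variable T : form -> Prop.
Hypothesis T_closed : subst_closed T.
Variable A0 : form.
Hypothesis A0_unprovable : ~ prv T nil A0.

Definition consistent (H : list form) : Prop := ~ prv T H Bot.

Definition list_boundN (H : list form) : nat := list_max (map boundN H).
Definition list_boundS (H : list form) : nat := list_max (map boundS H).

Lemma list_boundN_le H C : In C H -> boundN C <= list_boundN H.
Proof.
  intros HC. pose proof (proj1 (list_max_le (map boundN H) _) (le_n _)) as F.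
  rewrite Forall_forall in F; apply F, in_map, HC.
Qed.

Lemma list_boundS_le H C : In C H -> boundS C <= list_boundS H.
Proof.
  intros HC. pose proof (proj1 (list_max_le (map boundS H) _) (le_n _)) as F.
  rewrite Forall_forall in F; apply F, in_map, HC.
Qed.

(** Counterexamples to negated universal formulas are ordinary variables: every stage is a finite
    list, so a variable fresh for it exists and no new constants have to be added to the
    language. *)
Definition add_witness (A : form) (H : list form) : list form :=
  match A with
  | Imp (ForallN B) Bot => Not (instN (Var (list_boundN H)) B) :: H
  | Imp (ForallS B) Bot => Not (instS (list_boundS H) B) :: H
  | _ => H
  end.

Lemma add_witness_incl A H : incl H (add_witness A H).
Proof.
  destruct A as [| | | |A1 A2| |]; try apply incl_refl.
  destruct A1, A2; try apply incl_refl; apply incl_tl, incl_refl.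
Qed.

Lemma add_witness_consistent A H : In A H -> consistent H -> consistent (add_witness A H).
Proof.
  intros HA C. destruct A as [| | | |A1 A2| |]; try exact C.
  destruct A1, A2; try exact C; intros P; apply C; cbn in P.
  - apply prv_raa in P. apply prv_gen_fresh in P; auto using list_boundN_le.
    + eapply prv_impE; [apply prv_hyp; exact HA | exact P].
    + apply list_boundN_le in HA; cbn in HA; lia.
  - apply prv_raa in P. apply prv_gen_freshS in P; auto using list_boundS_le.
    + eapply prv_impE; [apply prv_hyp; exact HA | exact P].
    + apply list_boundS_le in HA; cbn in HA; lia.
Qed.

Definition extend (A : form) (H : list form) : list form :=
  if excluded_middle_informative (consistent (A :: H)) then add_witness A (A :: H) else H.

Fixpoint stage (n : nat) : list form :=
  match n with
  | O => Not A0 :: nil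
  (* If [n] codes no formula, [epsilon] returns some formula or other; trying it is harmless because
     [extend] preserves consistency. *)
  | S n => extend (epsilon (inhabits Bot) (fun A => code A = n)) (stage n)
  end.

Lemma stage_consistent n : consistent (stage n).
Proof.
  induction n; cbn.
  - intros P; apply A0_unprovable, prv_raa, P.
  - unfold extend; destruct excluded_middle_informative as [C|C]; auto.
    apply add_witness_consistent; auto. left; auto.
Qed.

Lemma stage_incl m n : m <= n -> incl (stage m) (stage n).
Proof.
  induction 1 as [|n _ IH]; [apply incl_refl|].
  eapply incl_tran; [exact IH|]. cbn; unfold extend.
  destruct excluded_middle_informative; [|apply incl_refl].
  eapply incl_tran; [|apply add_witness_incl]. apply incl_tl, incl_refl.
Qed.

Definition theory (A : form) : Prop := exists n, prv T (stage n) A.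

Lemma stage_code A : stage (S (code A)) = extend A (stage (code A)).
Proof.
  cbn. f_equal. apply code_inj.
  apply (epsilon_spec (inhabits Bot) (fun B => code B = code A)). now exists A.
Qed.

Lemma theory_mp A B : theory (Imp A B) -> theory A -> theory B.
Proof.
  intros [m P] [n Q]; exists (m + n).
  eapply prv_impE; eapply prv_weaken; eauto; apply stage_incl; lia.
Qed.

Lemma theory_nil A : prv T nil A -> theory A.
Proof. intros P; exists 0; eapply prv_weaken; [exact P | intros C []]. Qed.

Lemma theory_bot : ~ theory Bot.
Proof. intros [n P]; exact (@stage_consistent n P). Qed.

(** The only reason for not adding [A] at its own stage is that this stage refutes it. *)
Lemma theory_not A : ~ theory A -> theory (Not A).
Proof.
  intros N. exists (code A). apply prv_impI. apply NNPP; intros C.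
  apply N. exists (S (code A)). rewrite stage_code. unfold extend.
  destruct excluded_middle_informative as [_|E]; [|contradiction].
  apply prv_hyp, add_witness_incl. left; auto.
Qed.

Lemma theory_imp A B : theory (Imp A B) <-> (theory A -> theory B).
Proof.
  split; [apply theory_mp|]. intros I. destruct (classic (theory A)) as [HA|HA].
  - destruct (I HA) as [n P]. exists n. apply prv_impI.
    eapply prv_weaken; [exact P | apply incl_tl, incl_refl].
  - destruct (theory_not HA) as [n P]. exists n. apply prv_impI, prv_exfalso.
    eapply prv_impE; [|apply prv_hyp; left; reflexivity].
    eapply prv_weaken; [exact P | apply incl_tl, incl_refl].
Qed.

(** A formula of the theory cannot have been rejected when its turn came, since some later stage
    proves it; hence it was added together with its witness. *)
Lemma theory_stage A : theory A -> consistent (A :: stage (code A)).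
Proof.
  intros [n P] Q. apply (@stage_consistent (n + code A)).
  eapply prv_cut.
  - eapply prv_weaken; [exact P | apply stage_incl; lia].
  - eapply prv_weaken; [exact Q|]. intros C [<-|HC]; [left; auto | right].
    eapply stage_incl; [|exact HC]; lia.
Qed.

Lemma theory_allN B : theory (ForallN B) <-> forall t, theory (instN t B).
Proof.
  split.
  - intros [n P] t; exists n; apply prv_allNE, P.
  - intros I. apply NNPP; intros N. apply theory_not in N.
    pose proof (theory_stage N) as C. set (A := Not (ForallN B)) in *.
    pose proof (stage_code A) as E. unfold extend in E.
    destruct excluded_middle_informative as [_|F]; [|contradiction].
    cbn [add_witness A Not] in E.
    eapply theory_bot, theory_mp; [|apply I].
    exists (S (code A)). rewrite E. apply prv_hyp. left. reflexivity.
Qed.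

Lemma theory_allS B : theory (ForallS B) <-> forall X, theory (instS X B).
Proof.
  split.
  - intros [n P] t; exists n; apply prv_allSE, P.
  - intros I. apply NNPP; intros N. apply theory_not in N.
    pose proof (theory_stage N) as C. set (A := Not (ForallS B)) in *.
    pose proof (stage_code A) as E. unfold extend in E.
    destruct excluded_middle_informative as [_|F]; [|contradiction].
    cbn [add_witness A Not] in E.
    eapply theory_bot, theory_mp; [|apply I].
    exists (S (code A)). rewrite E. apply prv_hyp. left. reflexivity.
Qed.

Lemma theory_eq A s t : theory (Equal s t) -> theory (instN s A) -> theory (instN t A).
Proof.
  intros [m P] [n Q]; exists (m + n).
  eapply prv_eq; eapply prv_weaken; eauto; apply stage_incl; lia.
Qed.

Lemma theory_refl t : theory (Equal t t).
Proof. exists 0; apply prv_refl. Qed.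

Definition sameT (s t : term) : Prop := theory (Equal s t).

Definition tshift := tsubst (fun p => Var (S p)).

Lemma inst_tshift t u : tsubst (fun n => match n with O => t | S m => Var m end) (tshift u) = u.
Proof. unfold tshift; rewrite tsubst_comp; apply tsubst_id. Qed.

Lemma sameT_sym s t : sameT s t -> sameT t s.
Proof.
  intros E. pose proof (theory_eq (Equal (Var 0) (tshift s)) E) as P.
  unfold instN in P; cbn in P; rewrite !inst_tshift in P. apply P, theory_refl.
Qed.

Lemma sameT_trans s t u : sameT s t -> sameT t u -> sameT s u.
Proof.
  intros E F. pose proof (theory_eq (Equal (tshift s) (Var 0)) F) as P.
  unfold instN in P; cbn in P; rewrite !inst_tshift in P. apply P, E.
Qed.

(** A canonical representative for each class of provably equal terms, so that equality in the term
    model is genuine equality. *)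
Definition rep (t : term) : term := epsilon (inhabits TZero) (sameT t).

Lemma rep_same t : sameT t (rep t).
Proof. unfold rep; apply epsilon_spec. exists t. apply theory_refl. Qed.

Lemma rep_eq s t : sameT s t <-> rep s = rep t.
Proof.
  split.
  - intros E. unfold rep. f_equal. apply functional_extensionality; intros u.
    apply propositional_extensionality. split; eauto using sameT_trans, sameT_sym.
  - intros E. eapply sameT_trans; [apply rep_same|]. rewrite E. apply sameT_sym, rep_same.
Qed.

Definition tclass : Type := {t : term | rep t = t}.

Definition cls (t : term) : tclass :=
  exist _ (rep t) (eq_sym (proj1 (rep_eq t (rep t)) (rep_same t))).

Lemma cls_eq s t : cls s = cls t <-> sameT s t.
Proof.
  rewrite rep_eq. split; [intros E; exact (f_equal (@proj1_sig _ _) E)|].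
  intros E. apply eq_sig_hprop; auto. intros; apply proof_irrelevance.
Qed.

Lemma cls_proj c : cls (proj1_sig c) = c.
Proof.
  destruct c as [t E]; cbn. apply eq_sig_hprop; auto. intros; apply proof_irrelevance.
Qed.

(** The set variables themselves serve as the sets, without a quotient, because the language has no
    equality between sets. *)
Definition term_model : structure := {|
  num := tclass;
  sets := nat;
  mzero := cls TZero;
  mone := cls TOne;
  madd := fun a b => cls (Plus (proj1_sig a) (proj1_sig b));
  mmul := fun a b => cls (Times (proj1_sig a) (proj1_sig b));
  mlt := fun a b => theory (Less (proj1_sig a) (proj1_sig b));
  mem := fun a X => theory (Mem (proj1_sig a) X) |}.

Lemma theory_congr A s s' t t' : sameT s s' -> sameT t t' ->
  theory (subst (consN s (consN t Var)) (fun X => X) A) ->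
  theory (subst (consN s' (consN t' Var)) (fun X => X) A).
Proof.
  assert (I : forall u v, instN u (subst (consN (Var 0) (consN (tshift v) (fun n => Var (S n)))) (fun X => X) A)
    = subst (consN u (consN v Var)) (fun X => X) A).
  { intros u v; unfold instN; rewrite subst_comp; f_equal.
    apply functional_extensionality; intros [|[|n]]; cbn; auto. apply inst_tshift. }
  assert (J : forall u v, instN v (subst (consN (tshift u) (consN (Var 0) (fun n => Var (S n)))) (fun X => X) A)
    = subst (consN u (consN v Var)) (fun X => X) A).
  { intros u v; unfold instN; rewrite subst_comp; f_equal.
    apply functional_extensionality; intros [|[|n]]; cbn; auto. apply inst_tshift. }
  intros E F P. rewrite <- I in P. apply (theory_eq _ E) in P. rewrite I, <- J in P.
  apply (theory_eq _ F) in P. rewrite J in P. exact P.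
Qed.

Lemma theory_congr_iff A s s' t t' : sameT s s' -> sameT t t' ->
  theory (subst (consN s (consN t Var)) (fun X => X) A) <->
  theory (subst (consN s' (consN t' Var)) (fun X => X) A).
Proof. split; apply theory_congr; auto using sameT_sym. Qed.

Lemma rep_cong A s t : theory (subst (consN s (consN t Var)) (fun X => X) A) <->
  theory (subst (consN (rep s) (consN (rep t) Var)) (fun X => X) A).
Proof. apply theory_congr_iff; apply rep_same. Qed.

Lemma eval_cls f t : eval term_model (fun n => cls (f n)) t = cls (tsubst f t).
Proof.
  induction t as [| | |s IHs t IHt|s IHs t IHt]; cbn; auto; rewrite IHs, IHt; cbn; apply cls_eq, sameT_sym;
  [ set (op := Plus) | set (op := Times) ];
  pose proof (proj1 (rep_cong (Equal (op (tshift (tshift (tsubst f s))) (tshift (tshift (tsubst f t)))) (op (Var 0) (Var 1)))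
    (tsubst f s) (tsubst f t))) as P; cbn in P; unfold tshift in P; rewrite !tsubst_comp in P; cbn in P;
  rewrite <- !(tsubst_comp f Var), !tsubst_id in P; apply P, theory_refl.
Qed.

(** The truth lemma. The quantifier cases work because every element of the model is the class of a
    term and every set is a set variable; arbitrary [f] and [g] let the induction pass binders. *)
Lemma truth A : forall f g,
  sat term_model (fun n => cls (f n)) g A <-> theory (subst f g A).
Proof.
  induction A as [t u|t u|t X| |A IHA B IHB|A IHA|A IHA]; intros f g; cbn [sat subst].
  - rewrite !eval_cls. apply cls_eq.
  - rewrite !eval_cls. cbn.
    symmetry; apply (theory_congr_iff (Less (Var 0) (Var 1))); apply rep_same.
  - rewrite !eval_cls. cbn.
    symmetry; exact (theory_congr_iff (Mem (Var 0) (g X)) (rep_same (tsubst f t)) (theory_refl TZero)).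
  - split; [tauto | apply theory_bot].
  - rewrite theory_imp, IHA, IHB. tauto.
  - rewrite theory_allN. split.
    + intros S t. rewrite instN_up. apply IHA. specialize (S (cls t)).
      replace (fun n => cls (consN t f n)) with (consN (cls t) (fun n => cls (f n))); auto.
      apply functional_extensionality; intros [|n]; reflexivity.
    + intros P d. specialize (P (proj1_sig d)). rewrite instN_up in P. apply IHA in P.
      replace (consN d (fun n => cls (f n))) with (fun n => cls (consN (proj1_sig d) f n)); auto.
      apply functional_extensionality; intros [|n]; cbn; auto. apply cls_proj.
  - rewrite theory_allS. split; intros P X; specialize (P X).
    + rewrite instS_up. apply IHA, P.
    + rewrite instS_up in P. apply IHA, P.
Qed.

Lemma term_model_of : model_of T term_model.
Proof.
  intros A e s HA.
  replace e with (fun n => cls (proj1_sig (e n))).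
  - apply truth, theory_nil, prv_ax, T_closed, HA.
  - apply functional_extensionality; intros n; apply cls_proj.
Qed.

Lemma term_model_A0 : ~ sat term_model (fun n => cls (Var n)) (fun X => X) A0.
Proof.
  rewrite truth, subst_id. intros P. apply theory_bot.
  eapply theory_mp; [|exact P]. exists 0. apply prv_hyp; left; reflexivity.
Qed.

End Henkin.

Theorem completeness T A : subst_closed T ->
  (forall M, model_of T M -> forall e s, sat M e s A) -> prv T nil A.
Proof.
  intros HT HM. apply NNPP; intros N.
  apply (term_model_A0 HT N), HM, term_model_of; auto.
Qed.

(** * Substitution instances of the axioms *)

Lemma arithmetical_subst A : forall f g, arithmetical A -> arithmetical (subst f g A).
Proof. induction A; cbn; intuition. Qed.

Lemma ACA0_closed : subst_closed ACA0.
Proof.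
  intros f g A [B HB| |B HB].
  - replace (subst f g (B 0 0)) with (B 0 0); [now apply ACA0_basic|].
    repeat destruct HB as [<-|HB]; try reflexivity. destruct HB.
  - apply ACA0_induction.
  - replace (subst f g (comprehension B)) with (comprehension (subst (upN f) g B)).
    + apply ACA0_comprehension, arithmetical_subst, HB.
    + unfold comprehension; cbn; now rewrite subst_shiftS.
Qed.

(** * Arithmetical definability in a structure *)

Lemma eval_tsubst M e f t : eval M e (tsubst f t) = eval M (fun n => eval M e (f n)) t.
Proof. induction t; cbn; congruence. Qed.

Lemma all_iff_compat (A : Type) (P Q : A -> Prop) :
  (forall x, P x <-> Q x) -> ((forall x, P x) <-> (forall x, Q x)).
Proof. firstorder. Qed.

Lemma sat_subst M A : forall e s f g,
  sat M e s (subst f g A) <-> sat M (fun n => eval M e (f n)) (fun X => s (g X)) A.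
Proof.
  induction A as [t u|t u|t X| |A IHA B IHB|A IHA|A IHA]; intros e s f g; cbn; rewrite ?eval_tsubst; try tauto.
  - rewrite IHA, IHB; tauto.
  - apply all_iff_compat; intros d. rewrite IHA.
    replace (fun n => eval M (consN d e) (upN f n)) with (consN d (fun n => eval M e (f n))); [tauto|].
    apply functional_extensionality; intros [|n]; cbn; auto. now rewrite eval_tsubst.
  - apply all_iff_compat; intros X. rewrite IHA.
    replace (fun Y => consN X s (upS g Y)) with (consN X (fun Y => s (g Y))); [tauto|].
    apply functional_extensionality; intros [|n]; reflexivity.
Qed.

Section Connectives.
Variables (M : structure) (e : nat -> num M) (s : nat -> sets M).

Lemma sat_Not A P : (sat M e s A <-> P) -> (sat M e s (Not A) <-> ~ P).
Proof. cbn; tauto. Qed.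

Lemma sat_Imp A B P Q : (sat M e s A <-> P) -> (sat M e s B <-> Q) ->
  (sat M e s (Imp A B) <-> (P -> Q)).
Proof. cbn; tauto. Qed.

Lemma sat_And A B P Q : (sat M e s A <-> P) -> (sat M e s B <-> Q) ->
  (sat M e s (And A B) <-> P /\ Q).
Proof. cbn; tauto. Qed.

Lemma sat_Or A B P Q : (sat M e s A <-> P) -> (sat M e s B <-> Q) ->
  (sat M e s (Or A B) <-> P \/ Q).
Proof. cbn; tauto. Qed.

Lemma sat_Iff A B P Q : (sat M e s A <-> P) -> (sat M e s B <-> Q) ->
  (sat M e s (Iff A B) <-> (P <-> Q)).
Proof. cbn; tauto. Qed.

Lemma sat_ForallN A P : (forall d, sat M (consN d e) s A <-> P d) ->
  (sat M e s (ForallN A) <-> forall d, P d).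
Proof. intros H; cbn; apply all_iff_compat, H. Qed.

Lemma sat_ForallS A P : (forall X, sat M e (consN X s) A <-> P X) ->
  (sat M e s (ForallS A) <-> forall X, P X).
Proof. intros H; cbn; apply all_iff_compat, H. Qed.

Lemma sat_ExistsN A P : (forall d, sat M (consN d e) s A <-> P d) ->
  (sat M e s (ExistsN A) <-> exists d, P d).
Proof.
  intros H; cbn; split.
  - intros N; apply NNPP; intros F; apply N; intros d S; apply F; exists d; apply H, S.
  - intros [d S] N; exact (N d (proj2 (H d) S)).
Qed.

Lemma sat_ExistsS A P : (forall X, sat M e (consN X s) A <-> P X) ->
  (sat M e s (ExistsS A) <-> exists X, P X).
Proof.
  intros H; cbn; split.
  - intros N; apply NNPP; intros F; apply N; intros d S; apply F; exists d; apply H, S.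
  - intros [d S] N; exact (N d (proj2 (H d) S)).
Qed.
End Connectives.

(* Turns [sat M e s A <-> ?P] into the classical reading of [A]. *)
Ltac read_sat :=
  lazymatch goal with
  | |- sat _ _ _ (Not _) <-> _ => refine (@sat_Not _ _ _ _ _ _); read_sat
  | |- sat _ _ _ (And _ _) <-> _ => refine (@sat_And _ _ _ _ _ _ _ _ _); read_sat
  | |- sat _ _ _ (Or _ _) <-> _ => refine (@sat_Or _ _ _ _ _ _ _ _ _); read_sat
  | |- sat _ _ _ (Iff _ _) <-> _ => refine (@sat_Iff _ _ _ _ _ _ _ _ _); read_sat
  | |- sat _ _ _ (Imp _ _) <-> _ => refine (@sat_Imp _ _ _ _ _ _ _ _ _); read_sat
  | |- sat _ _ _ (ForallN _) <-> _ => refine (@sat_ForallN _ _ _ _ _ _); intro; read_sat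
  | |- sat _ _ _ (ForallS _) <-> _ => refine (@sat_ForallS _ _ _ _ _ _); intro; read_sat
  | |- sat _ _ _ (ExistsN _) <-> _ => refine (@sat_ExistsN _ _ _ _ _ _); intro; read_sat
  | |- sat _ _ _ (ExistsS _) <-> _ => refine (@sat_ExistsS _ _ _ _ _ _); intro; read_sat
  | |- sat _ _ _ _ <-> _ => cbn [sat eval consN]; apply iff_refl
  end.

(** The named binders are unfolded while the derived connectives stay folded, so that [read_sat]
    meets [And] or [ExistsN] and not their encodings by implication and falsity. *)
Ltac read_fm H :=
  let P := fresh in
  cbv -[sat And Or Not Iff ExistsN ExistsS num sets mzero mone madd mmul mlt mem] in H;
  match type of H with ?A => eassert (P : A <-> _) by read_sat end;
  let K := fresh in pose proof (proj1 P H) as K; clear P H; rename K into H; cbv beta in H.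

Section Definability.
Variable M : structure.
Local Notation D := (num M).

(* The formula defining a predicate of an environment [e] may have parameters:
   [e] occupies the even variables and the parameters the odd ones. *)
Definition mix {C : Type} (e r : nat -> C) (n : nat) : C :=
  if Nat.even n then e (Nat.div2 n) else r (Nat.div2 n).

Lemma mix_even C (e r : nat -> C) n : mix e r (2 * n) = e n.
Proof. unfold mix. now rewrite Nat.even_even, Nat.div2_double. Qed.

Lemma mix_odd C (e r : nat -> C) n : mix e r (S (2 * n)) = r n.
Proof. unfold mix. now rewrite Nat.even_succ, Nat.odd_even, Nat.div2_succ_double. Qed.

Lemma mix_mix C C' (f : C -> C') e r r' :
  (forall n, f (e n) = r (2 * n)) -> (forall n, f (r' n) = r (S (2 * n))) ->
  (fun n => f (mix e r' n)) = r.
Proof.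
  intros E F; apply functional_extensionality; intros n.
  destruct (Nat.Even_or_Odd n) as [[k ->]|[k ->]].
  - rewrite mix_even; apply E.
  - rewrite Nat.add_1_r, mix_odd; apply F.
Qed.

Definition arith (P : (nat -> D) -> Prop) : Prop :=
  exists A r s, arithmetical A /\ forall e, P e <-> sat M (mix e r) s A.

Definition is_term (t : (nat -> D) -> D) : Prop :=
  exists u r, forall e, t e = eval M (mix e r) u.

(** To combine two formulas, their parameter sequences are interleaved once more; [left_par] and
    [right_par] redirect the odd variables to the proper half and fix the even ones. *)
Definition left_par : nat -> term := mix (fun n => Var (2 * n)) (fun n => Var (S (2 * (2 * n)))).
Definition right_par : nat -> term := mix (fun n => Var (2 * n)) (fun n => Var (S (2 * S (2 * n)))).

Lemma eval_left_par e r r' : (fun n => eval M (mix e (mix r r')) (left_par n)) = mix e r.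
Proof. apply mix_mix; intros n; cbn [eval]; now rewrite ?mix_even, ?mix_odd, ?mix_even, ?mix_odd. Qed.

Lemma eval_right_par e r r' : (fun n => eval M (mix e (mix r r')) (right_par n)) = mix e r'.
Proof. apply mix_mix; intros n; cbn [eval]; now rewrite ?mix_even, ?mix_odd, ?mix_odd. Qed.

Lemma is_term_var i : is_term (fun e => e i).
Proof. exists (Var (2 * i)), (fun _ => mzero M). intros e; cbn [eval]; now rewrite mix_even. Qed.

Lemma is_term_const d : is_term (fun _ => d).
Proof. exists (Var 1), (fun _ => d). reflexivity. Qed.

Lemma is_term_op (op : D -> D -> D) (Op : term -> term -> term) t u :
  (forall e a b, eval M e (Op a b) = op (eval M e a) (eval M e b)) ->
  is_term t -> is_term u -> is_term (fun e => op (t e) (u e)).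
Proof.
  intros H [a [r E]] [b [r' F]]. exists (Op (tsubst left_par a) (tsubst right_par b)), (mix r r').
  intros e. rewrite H, !eval_tsubst, eval_left_par, eval_right_par, E, F. reflexivity.
Qed.

Lemma is_term_add t u : is_term t -> is_term u -> is_term (fun e => madd M (t e) (u e)).
Proof. apply is_term_op with (Op := Plus). reflexivity. Qed.

Lemma is_term_mul t u : is_term t -> is_term u -> is_term (fun e => mmul M (t e) (u e)).
Proof. apply is_term_op with (Op := Times). reflexivity. Qed.

Lemma is_term_rename t f : is_term t -> is_term (fun e => t (fun n => e (f n))).
Proof.
  intros [u [r E]].
  exists (tsubst (mix (fun n => Var (2 * f n)) (fun n => Var (S (2 * n)))) u), r.
  intros e. rewrite E, eval_tsubst. f_equal. symmetry. apply mix_mix; intros n; cbn [eval].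
  - now rewrite !mix_even.
  - now rewrite !mix_odd.
Qed.

Lemma arith_ext P Q : (forall e, P e <-> Q e) -> arith P -> arith Q.
Proof.
  intros H [A [r [s [HA E]]]]. exists A, r, s. split; auto. intros e; rewrite <- H; auto.
Qed.

(* Even formulas without set variables are satisfied relative to an assignment of sets. *)
Variable X0 : sets M.

Lemma arith_rel (Rel : D -> D -> Prop) (F : term -> term -> form) t u :
  (forall e s a b, sat M e s (F a b) <-> Rel (eval M e a) (eval M e b)) ->
  (forall a b, arithmetical (F a b)) ->
  is_term t -> is_term u -> arith (fun e => Rel (t e) (u e)).
Proof.
  intros H HF [a [r E]] [b [r' E']].
  exists (F (tsubst left_par a) (tsubst right_par b)), (mix r r'), (fun _ => X0).
  split; [apply HF|]. intros e.
  rewrite H, !eval_tsubst, eval_left_par, eval_right_par, E, E'. reflexivity.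
Qed.

Lemma arith_eq t u : is_term t -> is_term u -> arith (fun e => t e = u e).
Proof. apply arith_rel with (F := Equal); cbn; tauto. Qed.

Lemma arith_lt t u : is_term t -> is_term u -> arith (fun e => mlt M (t e) (u e)).
Proof. apply arith_rel with (F := Less); cbn; tauto. Qed.

Lemma arith_mem t X : is_term t -> arith (fun e => mem M (t e) X).
Proof.
  intros [u [r E]]. exists (Mem u 0), r, (fun _ => X).
  split; [exact I|]. intros e; cbn. now rewrite E.
Qed.

Lemma arith_False : arith (fun _ => False).
Proof. exists Bot, (fun _ => mzero M), (fun _ => X0). cbn; tauto. Qed.

Lemma arith_imp P Q : arith P -> arith Q -> arith (fun e => P e -> Q e).
Proof.
  intros [A [r [s [HA E]]]] [B [r' [s' [HB F]]]].
  exists (Imp (subst left_par (fun X => 2 * X) A) (subst right_par (fun X => S (2 * X)) B)),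
    (mix r r'), (mix s s').
  split; [split; apply arithmetical_subst; auto|]. intros e; cbn [sat].
  rewrite !sat_subst, eval_left_par, eval_right_par, E, F.
  replace (fun X => mix s s' (2 * X)) with s; [replace (fun X => mix s s' (S (2 * X))) with s'; [tauto|]|];
    apply functional_extensionality; intros n; now rewrite ?mix_even, ?mix_odd.
Qed.

Lemma arith_all (P : D -> (nat -> D) -> Prop) :
  arith (fun e => P (e 0) (fun n => e (S n))) -> arith (fun e => forall x, P x e).
Proof.
  intros [A [r [s [HA E]]]].
  (* [A] expects the bound variable at position 0 and the older variables moved up within the even
     positions, whereas the quantifier moves every index up by one; [f] converts between the two
     layouts. *)
  set (f := mix (fun n => match n with O => Var 0 | S m => Var (S (2 * m)) end)
               (fun n => Var (S (S (2 * n))))).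
  exists (ForallN (subst f (fun X => X) A)), r, s.
  split; [apply arithmetical_subst; auto|]. intros e; cbn [sat].
  apply all_iff_compat; intros x.
  rewrite (E (consN x e)), sat_subst. cbn [consN].
  replace (fun n => eval M (consN x (mix e r)) (f n)) with (mix (consN x e) r); [tauto|].
  symmetry; apply mix_mix; intros n.
  - unfold f. rewrite !mix_even. destruct n as [|n]; [reflexivity|]. exact (mix_even e r n).
  - unfold f. rewrite !mix_odd. exact (mix_odd e r n).
Qed.

Lemma arith_not P : arith P -> arith (fun e => ~ P e).
Proof. intros H. apply arith_imp; auto using arith_False. Qed.

Lemma arith_and P Q : arith P -> arith Q -> arith (fun e => P e /\ Q e).
Proof.
  intros H K. apply arith_ext with (fun e => ~ (P e -> ~ Q e)); [intros; tauto|].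
  auto using arith_not, arith_imp.
Qed.

Lemma arith_or P Q : arith P -> arith Q -> arith (fun e => P e \/ Q e).
Proof.
  intros H K. apply arith_ext with (fun e => ~ P e -> Q e); [intros; tauto|].
  auto using arith_not, arith_imp.
Qed.

Lemma arith_iff P Q : arith P -> arith Q -> arith (fun e => P e <-> Q e).
Proof. intros H K. apply arith_and; apply arith_imp; auto. Qed.

Lemma arith_ex (P : D -> (nat -> D) -> Prop) :
  arith (fun e => P (e 0) (fun n => e (S n))) -> arith (fun e => exists x, P x e).
Proof.
  intros H. apply arith_ext with (fun e => ~ forall x, ~ P x e).
  - intros e; split.
    + intros N; apply NNPP; intros F; apply N; intros x Px; apply F; exists x; auto.
    + intros [x Px] N; exact (N x Px).
  - apply arith_not, (arith_all (fun x e => ~ P x e)), arith_not, H.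
Qed.

(** Classically a proposition that does not depend on the environment is as good as [True] or
    [False], however complex it is. *)
Lemma arith_prop (P : Prop) : arith (fun _ => P).
Proof.
  destruct (classic P).
  - apply arith_ext with (fun _ => ~ False); [tauto | apply arith_not, arith_False].
  - apply arith_ext with (fun _ => False); [tauto | apply arith_False].
Qed.

(** Arguments are arbitrary terms rather than variables, so that such a hypothesis applies wherever
    the predicate occurs, also below quantifiers. *)
Definition arith1 (P : D -> Prop) : Prop :=
  forall t, is_term t -> arith (fun e => P (t e)).
Definition arith2 (P : D -> D -> Prop) : Prop :=
  forall t u, is_term t -> is_term u -> arith (fun e => P (t e) (u e)).
Definition arith3 (P : D -> D -> D -> Prop) : Prop :=
  forall t u v, is_term t -> is_term u -> is_term v -> arith (fun e => P (t e) (u e) (v e)).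
Definition arith4 (P : D -> D -> D -> D -> Prop) : Prop :=
  forall t u v w, is_term t -> is_term u -> is_term v -> is_term w ->
    arith (fun e => P (t e) (u e) (v e) (w e)).

End Definability.

(** Extension point of [arith_step], redefined when a new function or predicate has been shown
    definable. *)
Ltac arith_hook := fail.

Ltac term_step :=
  match goal with
  | |- is_term _ (fun e => e _) => apply is_term_var
  | |- is_term _ (fun _ => ?d) => apply is_term_const
  | |- is_term _ (fun e => madd _ _ _) => apply is_term_add
  | |- is_term _ (fun e => mmul _ _ _) => apply is_term_mul
  | H : is_term _ _ |- _ => first [exact H | apply (is_term_rename _ H)]
  end.

Ltac arith_step X0 :=
  first
  [ term_step
  | arith_hook
  | match goal with
    | |- arith1 _ _ => intros ? ?
    | |- arith2 _ _ => intros ? ? ? ?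
    | |- arith3 _ _ => intros ? ? ? ? ? ?
    | |- arith4 _ _ => intros ? ? ? ? ? ? ? ?
    | H : arith1 _ ?P |- arith _ (fun e => ?P _) => apply H
    | H : arith2 _ ?P |- arith _ (fun e => ?P _ _) => apply H
    | H : arith3 _ ?P |- arith _ (fun e => ?P _ _ _) => apply H
    | H : arith4 _ ?P |- arith _ (fun e => ?P _ _ _ _) => apply H
    | |- arith _ (fun _ => ?P) => apply (arith_prop X0)
    | |- arith _ (fun e => _ /\ _) => apply (arith_and X0)
    | |- arith _ (fun e => _ \/ _) => apply (arith_or X0)
    | |- arith _ (fun e => ~ _) => apply (arith_not X0)
    | |- arith _ (fun e => _ <-> _) => apply (arith_iff X0)
    | |- arith _ (fun e => _ = _) => apply (arith_eq X0)
    | |- arith _ (fun e => mlt _ _ _) => apply (arith_lt X0)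
    | |- arith _ (fun e => mem _ _ _) => apply arith_mem
    | |- arith _ (fun e => exists x, _) => apply (arith_ex X0); cbv beta
    | |- arith _ (fun e => _ -> _) => apply arith_imp
    | |- arith _ (fun e => forall x, _) => apply arith_all; cbv beta
    end ].

Ltac arith_tac X0 := cbv beta; repeat arith_step X0.

Ltac read_goal :=
  cbv -[sat And Or Not Iff ExistsN ExistsS num sets mzero mone madd mmul mlt mem];
  let P := fresh in
  match goal with |- ?A => eassert (P : A <-> _) by read_sat end;
  apply (proj2 P); clear P; cbv beta.

(** * Arithmetic in a model of ACA_0 *)

Section Arithmetic.
Variable M : structure.
Hypothesis HM : model_of ACA0 M.
Variable X0 : sets M.
Local Notation D := (num M).

Declare Scope num_scope.
Delimit Scope num_scope with num.
Local Open Scope num_scope.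
Local Notation "0" := (mzero M) : num_scope.
Local Notation "1" := (mone M) : num_scope.
Local Notation "x + y" := (madd M x y) : num_scope.
Local Notation "x * y" := (mmul M x y) : num_scope.
Local Notation "x < y" := (mlt M x y) : num_scope.
Definition mle (x y : D) : Prop := x < y \/ x = y.
Local Notation "x <= y" := (mle x y) : num_scope.

Ltac arith := arith_tac X0.

Lemma comprehension1 (P : D -> Prop) :
  arith1 M P -> exists X, forall n, mem M n X <-> P n.
Proof.
  intros HP. destruct (HP (fun e => e O) (is_term_var M O)) as [A [r [s [HA E]]]].
  (* Only position 0 of the mixed assignment depends on [n]; the rest, with zeros in the idle even
     positions, is the parameter assignment of the comprehension axiom. *)
  set (tail := fun k => mix (fun _ => 0) r (S k)).
  assert (Hmix : forall n, mix (consN n (fun _ => 0)) r = consN n tail).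
  { intros n. apply functional_extensionality; intros [|k]; [reflexivity|].
    unfold tail, mix. cbn [consN]. destruct (Nat.even (S k)) eqn:Ev; auto.
    destruct k as [|k]; [discriminate | reflexivity]. }
  pose proof (@HM _ tail s (ACA0_comprehension HA)) as C.
  unfold comprehension in C. eassert (R : sat M tail s _ <-> _).
  2: apply (proj1 R) in C; clear R.
  { apply sat_ExistsS; intros X. apply sat_ForallN; intros n. apply sat_Iff; apply iff_refl. }
  destruct C as [X C]. exists X. intros n.
  specialize (C n). cbn in C. rewrite C. unfold shiftS. rewrite sat_subst. cbn.
  rewrite <- (Hmix n). symmetry. exact (E (consN n (fun _ => 0))).
Qed.

Lemma arith_ind (P : D -> Prop) :
  arith1 M P -> P 0 -> (forall n, P n -> P (n + 1)) -> forall n, P n.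
Proof.
  intros HP H0 HS. destruct (comprehension1 HP) as [X HX].
  pose proof (@HM _ (fun _ => 0) (fun _ => X0) ACA0_induction) as I.
  read_fm I. specialize (I X). intros n. apply HX, I. split.
  - apply HX, H0.
  - intros k Hk. apply HX, HS, HX, Hk.
Qed.

Ltac basic i :=
  let H := fresh in
  pose proof (@HM _ (fun _ => 0) (fun _ => X0) (@ACA0_basic (nth i basic_axioms (notF (fun _ _ => Bot)))
    ltac:(cbn [nth basic_axioms]; repeat first [left; reflexivity | right]))) as H;
  read_fm H; exact H.

Lemma succ_ne_0 n : n + 1 <> 0.
Proof. revert n; basic O. Qed.
Lemma succ_inj m n : m + 1 = n + 1 -> m = n.
Proof. revert m n; basic 1%nat. Qed.
Lemma add_0_r m : m + 0 = m.
Proof. revert m; basic 2%nat. Qed.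
Lemma add_succ_r m n : m + (n + 1) = (m + n) + 1.
Proof. revert m n; basic 3%nat. Qed.
Lemma mul_0_r m : m * 0 = 0.
Proof. revert m; basic 4%nat. Qed.
Lemma mul_succ_r m n : m * (n + 1) = m * n + m.
Proof. revert m n; basic 5%nat. Qed.
Lemma not_lt_0 m : ~ m < 0.
Proof. revert m; basic 6%nat. Qed.
Lemma lt_succ m n : m < n + 1 <-> m <= n.
Proof. revert m n; basic 7%nat. Qed.

Ltac ind n := pattern n; apply arith_ind; [arith | |]; clear n.

Lemma add_0_l n : 0 + n = n.
Proof.
  ind n; [apply add_0_r | intros n IH]. now rewrite add_succ_r, IH.
Qed.

Lemma add_assoc a b c : a + (b + c) = (a + b) + c.
Proof.
  ind c; [now rewrite !add_0_r | intros c IH]. now rewrite !add_succ_r, IH.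
Qed.

Lemma add_1_l n : 1 + n = n + 1.
Proof.
  ind n; [now rewrite add_0_l, add_0_r | intros n IH]. now rewrite add_assoc, IH.
Qed.

Lemma add_comm a b : a + b = b + a.
Proof.
  ind b; [now rewrite add_0_l, add_0_r | intros b IH].
  now rewrite add_succ_r, IH, <- add_1_l, add_assoc, add_1_l.
Qed.

Lemma mul_0_l n : 0 * n = 0.
Proof.
  ind n; [apply mul_0_r | intros n IH]. now rewrite mul_succ_r, IH, add_0_r.
Qed.

Lemma mul_1_r n : n * 1 = n.
Proof. rewrite <- (add_0_l 1), mul_succ_r, mul_0_r. apply add_0_l. Qed.

Lemma mul_1_l n : 1 * n = n.
Proof.
  ind n; [apply mul_0_r | intros n IH]. now rewrite mul_succ_r, IH.
Qed.

Lemma mul_add_r a b c : a * (b + c) = a * b + a * c.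
Proof.
  ind c; [now rewrite mul_0_r, !add_0_r | intros c IH].
  now rewrite add_assoc, !mul_succ_r, IH, add_assoc.
Qed.

Lemma mul_add_l a b c : (a + b) * c = a * c + b * c.
Proof.
  ind c; [now rewrite !mul_0_r, add_0_r | intros c IH].
  rewrite !mul_succ_r, IH, <- !add_assoc. f_equal.
  now rewrite !add_assoc, (add_comm (b * c) a).
Qed.

Lemma mul_comm a b : a * b = b * a.
Proof.
  ind b; [now rewrite mul_0_l, mul_0_r | intros b IH].
  now rewrite mul_succ_r, mul_add_l, mul_1_l, IH.
Qed.

Lemma mul_assoc a b c : a * (b * c) = (a * b) * c.
Proof.
  ind c; [now rewrite !mul_0_r | intros c IH].
  now rewrite !mul_succ_r, mul_add_r, IH.
Qed.

Lemma num_semiring : semi_ring_theory 0 1 (madd M) (mmul M) (@eq D).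
Proof.
  constructor; auto using add_0_l, add_comm, add_assoc, mul_1_l, mul_0_l, mul_comm, mul_assoc, mul_add_l.
Qed.
Add Ring num_ring : num_semiring.

Lemma add_cancel_r a b c : a + c = b + c -> a = b.
Proof.
  ind c; [now rewrite !add_0_r | intros c IH E].
  rewrite !add_assoc in E. apply IH, succ_inj, E.
Qed.

Lemma add_cancel_l a b c : c + a = c + b -> a = b.
Proof. rewrite !(add_comm c). apply add_cancel_r. Qed.

Lemma zero_or_succ n : n = 0 \/ exists m, n = m + 1.
Proof. ind n; [now left | intros n _; right; now exists n]. Qed.

Lemma add_eq_0 a b : a + b = 0 -> a = 0 /\ b = 0.
Proof.
  destruct (zero_or_succ b) as [->|[b' ->]].
  - rewrite add_0_r; auto.
  - rewrite add_assoc. intros E; destruct (succ_ne_0 _ E).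
Qed.

Lemma lt_iff m n : m < n <-> exists k, n = m + k + 1.
Proof.
  ind n.
  - split; [intros H; destruct (not_lt_0 _ H)|]. intros [k E]; destruct (succ_ne_0 _ (eq_sym E)).
  - intros n IH. rewrite lt_succ. unfold mle. rewrite IH. split.
    + intros [[k ->]|<-]; [exists (k + 1) | exists 0]; ring.
    + intros [k E]. apply succ_inj in E. destruct (zero_or_succ k) as [->|[k' ->]].
      * right. now rewrite add_0_r in E.
      * left. exists k'. rewrite E; ring.
Qed.

Lemma le_iff m n : m <= n <-> exists k, n = m + k.
Proof.
  rewrite <- lt_succ, lt_iff. split; intros [k E]; exists k.
  - apply succ_inj, E.
  - now rewrite E.
Qed.

Lemma lt_irrefl n : ~ n < n.
Proof.
  rewrite lt_iff. intros [k E]. apply (succ_ne_0 k).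
  apply (add_cancel_l _ _ n). rewrite add_0_r, add_assoc. auto.
Qed.

Lemma lt_trans a b c : a < b -> b < c -> a < c.
Proof. rewrite !lt_iff. intros [k ->] [l ->]. exists (k + 1 + l). ring. Qed.

Lemma le_refl n : n <= n.
Proof. now right. Qed.

Lemma lt_le_trans a b c : a < b -> b <= c -> a < c.
Proof. intros H [K|<-]; auto. eapply lt_trans; eauto. Qed.

Lemma lt_succ_diag n : n < n + 1.
Proof. apply lt_succ, le_refl. Qed.

Lemma le_0 n : 0 <= n.
Proof. apply le_iff. exists n. now rewrite add_0_l. Qed.

Lemma lt_succ_le a b : a < b <-> a + 1 <= b.
Proof.
  rewrite lt_iff, le_iff. split; intros [k ->]; exists k; ring.
Qed.

Lemma lt_trichotomy a b : a < b \/ a = b \/ b < a.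
Proof.
  ind a.
  - destruct (le_0 b); auto.
  - intros a [H|[->|H]].
    + apply lt_succ_le in H. destruct H; auto.
    + right; right; apply lt_succ_diag.
    + right; right. apply lt_succ. now left.
Qed.

Lemma le_or_lt a b : a <= b \/ b < a.
Proof. unfold mle. destruct (lt_trichotomy a b) as [|[|]]; auto. Qed.

Lemma not_lt a b : ~ a < b <-> b <= a.
Proof.
  split.
  - destruct (le_or_lt b a); tauto.
  - intros H K. apply (lt_irrefl a). eapply lt_le_trans; eauto.
Qed.

Lemma le_antisym a b : a <= b -> b <= a -> a = b.
Proof.
  intros [H|H] K; auto. destruct (lt_irrefl a). eapply lt_le_trans; eauto.
Qed.

Lemma ex_max a b : exists c, a <= c /\ b <= c.
Proof.
  exists (a + b). split; apply le_iff; [exists b | exists a]; auto using add_comm.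
Qed.

(** ** Consequences of arithmetical induction *)

Lemma arith_le t u : is_term M t -> is_term M u -> arith M (fun e => t e <= u e).
Proof. intros; unfold mle; arith. Qed.

Ltac arith_hook ::= apply arith_le.

Lemma strong_ind (P : D -> Prop) : arith1 M P ->
  (forall n, (forall m, m < n -> P m) -> P n) -> forall n, P n.
Proof.
  intros HP H n. assert (K : forall m, m < n + 1 -> P m); [|apply K, lt_succ_diag].
  ind n.
  - intros m Hm. apply H. intros k Hk. apply lt_succ in Hm.
    destruct (not_lt_0 k). eapply lt_le_trans; eauto.
  - intros n IH m Hm. apply lt_succ in Hm. destruct Hm as [Hm| ->]; auto.
Qed.

Lemma least (P : D -> Prop) n : arith1 M P -> P n ->
  exists m, P m /\ forall k, P k -> m <= k.
Proof.
  intros HP Pn. apply NNPP; intros N. revert Pn. revert n.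
  apply (@strong_ind (fun n => ~ P n)); [arith|].
  intros n IH Pn. apply N. exists n. split; auto. intros k Pk. apply not_lt. intros H.
  exact (IH k H Pk).
Qed.

(** The least upper bound is attained, for otherwise its predecessor would be an upper bound too. *)
Lemma greatest (P : D -> Prop) n b : arith1 M P -> P n -> (forall k, P k -> k <= b) ->
  exists m, P m /\ forall k, P k -> k <= m.
Proof.
  intros HP Pn Hb.
  destruct (@least (fun m => forall k, P k -> k <= m) b) as [m [Hm Hl]]; [arith | auto |].
  exists m. split; auto. apply NNPP; intros N.
  destruct (zero_or_succ m) as [->|[m' ->]].
  - destruct (Hm n Pn) as [H|H]; [exact (not_lt_0 _ H) | subst; auto].
  - apply (lt_irrefl m'). apply lt_succ_le, Hl. intros k Pk.
    destruct (Hm k Pk) as [H| ->]; [apply lt_succ, H | contradiction].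
Qed.

(** Collection for arithmetical predicates. After compactness it replaces levels found separately
    for boundedly many basic sets by a common one. *)
Lemma bounding (Q : D -> D -> Prop) b : arith2 M Q ->
  (forall i, i < b -> exists n, Q i n) -> exists N, forall i, i < b -> exists n, n < N /\ Q i n.
Proof.
  intros HQ. ind b.
  - exists 0. intros i Hi; destruct (not_lt_0 _ Hi).
  - intros b IH H. destruct IH as [N HN].
    { intros i Hi. apply H. apply lt_succ. now left. }
    destruct (H b (lt_succ_diag b)) as [n Hn].
    destruct (ex_max N (n + 1)) as [K [HK1 HK2]]. exists K.
    intros i Hi. apply lt_succ in Hi. destruct Hi as [Hi| ->].
    + destruct (HN i Hi) as [m [Hm Qm]]. exists m. split; auto. eapply lt_le_trans; eauto.
    + exists n. split; auto. now apply lt_succ_le.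
Qed.

(** ** Pairs and finite sets *)

Definition mpair (x y : D) : D := (x + y) * (x + y) + x.
Local Notation "⟨ s , t ⟩" := (mpair s t) (at level 0, s at level 99, t at level 99) : num_scope.

Lemma is_term_pair t u : is_term M t -> is_term M u -> is_term M (fun e => ⟨t e, u e⟩).
Proof. intros; unfold mpair; arith. Qed.

Ltac arith_hook ::= first [apply is_term_pair | apply arith_le].

(** A pair with sum [s] has a code between the square of [s] and that square plus [s], below the
    next square. The witness is the difference of the two codes less one, expanded so that no
    subtraction occurs. *)
Lemma pair_lt x y x' y' : x + y < x' + y' -> ⟨x, y⟩ < ⟨x', y'⟩.
Proof.
  unfold mpair. rewrite lt_iff. intros [k ->].
  apply lt_iff. exists (y + (x + y) * (k + 1) + (x + y) * k + k * (k + 1) + k + x').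
  ring.
Qed.

Lemma pair_inj x y x' y' : ⟨x, y⟩ = ⟨x', y'⟩ -> x = x' /\ y = y'.
Proof.
  intros E. destruct (lt_trichotomy (x + y) (x' + y')) as [H|[H|H]].
  - apply pair_lt in H. rewrite E in H. destruct (lt_irrefl _ H).
  - unfold mpair in E. rewrite H in E. apply add_cancel_l in E. subst x'.
    split; auto. eapply add_cancel_l, H.
  - apply pair_lt in H. rewrite E in H. destruct (lt_irrefl _ H).
Qed.

Definition divides (p a : D) : Prop := exists q, a = q * p.

Lemma divides_mul p a c : divides p a -> divides p (c * a).
Proof. intros [q ->]. exists (c * q). ring. Qed.

Lemma divides_sub p a b : divides p (a + b) -> divides p a -> divides p b.
Proof.
  intros [q E] [r ->]. destruct (le_or_lt r q) as [H|H].
  - apply le_iff in H. destruct H as [k ->]. exists k.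
    apply (add_cancel_l _ _ (r * p)). rewrite E. ring.
  - apply lt_iff in H. destruct H as [k ->]. exists 0. rewrite mul_0_l.
    apply (add_eq_0 ((k + 1) * p) b). apply (add_cancel_l _ _ (q * p)).
    transitivity ((q + k + 1) * p + b); [ring|]. rewrite E. ring.
Qed.

(* Goedel's beta function: these numbers are pairwise coprime for the i below n
   when every positive number up to n divides b. *)
Definition modulus (b i : D) : D := (i + 1) * b + 1.

(** Coprimality in the form of Euclid's lemma: closure under products becomes immediate, and
    Bezout's identity is avoided. *)
Definition coprime (p a : D) : Prop := forall c, divides p (c * a) -> divides p c.

Lemma coprime_mul p a b : coprime p a -> coprime p b -> coprime p (a * b).
Proof. intros Ha Hb c H. apply Ha, Hb. rewrite <- mul_assoc. exact H. Qed.

(** Modulo [modulus b i] the number [(i + 1) * b] is -1, so every divisor of [b] is invertible and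
    can be cancelled. *)
Lemma modulus_coprime_diff b i c k : divides k b ->
  divides (modulus b i) (c * k) -> divides (modulus b i) c.
Proof.
  intros [q E] H. apply divides_sub with (c * ((i + 1) * b)).
  - exists c. unfold modulus. ring.
  - replace (c * ((i + 1) * b)) with ((i + 1) * q * (c * k)) by (rewrite E; ring).
    now apply divides_mul.
Qed.

(** Multiplying the j-th modulus by [i + 1] and the i-th by [j + 1] makes the terms in [b] agree.
    What remains is the difference of [i] and [j], which is positive and at most [n] and hence
    divides [b]. *)
Lemma modulus_coprime n b i j : (forall k, k < n -> divides (k + 1) b) ->
  i < n -> j < n -> i <> j -> coprime (modulus b i) (modulus b j).
Proof.
  intros Hb Hi Hj N c H.
  assert (H1 : divides (modulus b i) (c * (i + 1) * modulus b j)).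
  { replace (c * (i + 1) * modulus b j) with ((i + 1) * (c * modulus b j)) by ring.
    now apply divides_mul. }
  assert (H2 : divides (modulus b i) (c * (j + 1) * modulus b i)) by (eexists; reflexivity).
  assert (Hk : forall l k, l < n -> l = k + i + 1 \/ l = k + j + 1 -> divides (k + 1) b).
  { intros l k Hl E. apply Hb. eapply lt_trans; [|exact Hl]. apply lt_iff.
    destruct E as [->| ->]; eexists; reflexivity. }
  destruct (lt_trichotomy i j) as [L|[L|L]]; [|contradiction|]; apply lt_iff in L; destruct L as [k L].
  - apply modulus_coprime_diff with (k + 1).
    + apply (Hk j); auto. left. rewrite L; ring.
    + eapply divides_sub; [|exact H1].
      replace (c * (i + 1) * modulus b j + c * (k + 1)) with (c * (j + 1) * modulus b i); auto.
      unfold modulus. rewrite L. ring.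
  - apply modulus_coprime_diff with (k + 1).
    + apply (Hk i); auto. right. rewrite L; ring.
    + eapply divides_sub; [|exact H2].
      replace (c * (j + 1) * modulus b i + c * (k + 1)) with (c * (i + 1) * modulus b j); auto.
      unfold modulus. rewrite L. ring.
Qed.

Lemma common_multiple n : exists b, b <> 0 /\ forall k, k < n -> divides (k + 1) b.
Proof.
  pattern n; apply arith_ind; [unfold divides; arith | |]; clear n.
  - exists 1. split; [|intros k Hk; destruct (not_lt_0 _ Hk)].
    rewrite <- (add_0_l 1). apply succ_ne_0.
  - intros n [b [Nb Hb]]. exists (b * (n + 1)). split.
    + intros E. rewrite mul_succ_r in E. apply add_eq_0 in E. now apply Nb.
    + intros k Hk. apply lt_succ in Hk. destruct Hk as [Hk| ->].
      * rewrite mul_comm. apply divides_mul; auto.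
      * exists b; auto.
Qed.

Lemma modulus_not_unit b i : b <> 0 -> ~ divides (modulus b i) 1.
Proof.
  intros Nb [q E]. destruct (zero_or_succ q) as [->|[q' ->]].
  - rewrite mul_0_l in E. apply (succ_ne_0 0). now rewrite add_0_l.
  - apply Nb. apply (add_eq_0 (q' * modulus b i + i * b) b).
    apply (add_cancel_l _ _ 1). rewrite add_0_r. etransitivity; [|symmetry; exact E].
    unfold modulus. ring.
Qed.

(** The beta function read as membership: divisibility by the i-th modulus is one bit. The bound [n]
    inside the code keeps every coded set bounded; numbers of another shape code the empty set. *)
Definition elem (i c : D) : Prop :=
  exists n a b, c = ⟨n, ⟨a, b⟩⟩ /\ i < n /\ divides (modulus b i) a.

Lemma arith_elem t u : is_term M t -> is_term M u -> arith M (fun e => elem (t e) (u e)).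
Proof. intros; unfold elem, divides, modulus; arith. Qed.

Lemma elem_lt c : exists n, forall i, elem i c -> i < n.
Proof.
  destruct (classic (exists n x, c = ⟨n, x⟩)) as [[n [x ->]]|N].
  - exists n. intros i [n' [a [b [E [H _]]]]]. apply pair_inj in E. destruct E as [-> _]. exact H.
  - exists 0. intros i [n [a [b [E _]]]]. destruct N. eauto.
Qed.

Lemma finite_coding (P : D -> Prop) n : arith1 M P ->
  exists c, forall i, elem i c <-> i < n /\ P i.
Proof.
  intros HP. destruct (common_multiple n) as [b [Nb Hb]].
  (* [a] is the product of the moduli of those [i < m] that satisfy [P]; the coprimality clause
     excludes accidental divisibility by the other moduli. *)
  assert (K : forall m, m <= n -> exists a, forall i, i < n ->
    (i < m -> P i -> divides (modulus b i) a) /\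
    (~ (i < m /\ P i) -> coprime (modulus b i) a)).
  { intros m. pattern m; apply arith_ind; [unfold divides, modulus, coprime, divides, modulus; arith | |]; clear m.
    - intros _. exists 1. intros i _. split; [intros H; destruct (not_lt_0 _ H)|].
      intros _ c. rewrite mul_1_r. auto.
    - intros m IH Hm. apply lt_succ_le in Hm. destruct IH as [a Ha]; [now left|].
      destruct (classic (P m)) as [Pm|Pm].
      + exists (a * modulus b m). intros i Hi. destruct (Ha i Hi) as [H1 H2]. split.
        * intros H Pi. apply lt_succ in H. destruct H as [H| ->].
          { rewrite mul_comm. apply divides_mul; auto. }
          { exists a; auto. }
        * intros N. apply coprime_mul.
          { apply H2. intros [H Pi]. apply N; split; auto. apply lt_succ. now left. }
          { apply modulus_coprime with n; auto. intros ->. apply N. split; auto. apply lt_succ_diag. }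
      + exists a. intros i Hi. destruct (Ha i Hi) as [H1 H2].
        assert (E : i < m + 1 /\ P i <-> i < m /\ P i).
        { split; intros [H Pi]; split; auto; [|apply lt_succ; now left].
          apply lt_succ in H. destruct H as [H| ->]; tauto. }
        split; [intros H Pi; apply H1; tauto | rewrite E; exact H2]. }
  destruct (K n (le_refl n)) as [a Ha]. exists ⟨n, ⟨a, b⟩⟩. intros i. split.
  - intros [n' [a' [b' [E [Hi Hd]]]]]. apply pair_inj in E. destruct E as [<- E].
    apply pair_inj in E. destruct E as [<- <-]. split; auto. apply NNPP; intros N.
    apply (@modulus_not_unit b i Nb), (proj2 (Ha i Hi)); [tauto|]. now rewrite mul_1_l.
  - intros [Hi Pi]. exists n, a, b. split; [|split]; auto. now apply (proj1 (Ha i Hi)).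
Qed.

Lemma finite_coding_bounded (P : D -> Prop) n : arith1 M P -> (forall i, P i -> i < n) ->
  exists c, forall i, elem i c <-> P i.
Proof.
  intros HP Hn. destruct (@finite_coding P n HP) as [c Hc]. exists c.
  intros i. rewrite Hc. split; [tauto | auto].
Qed.

Unset Strict Implicit.

Ltac arith_hook ::= first [apply is_term_pair | apply arith_le | apply arith_elem].

(** * Separation by clopen sets in a compact Hausdorff space *)

Section Space.
Variables (P : D -> Prop) (B : D -> D -> Prop).

Definition union (c v : D) : Prop := exists i, elem i c /\ B i v.

Definition clopen (c : D) : Prop :=
  forall w, P w -> exists i, B i w /\
    ((forall v, B i v -> union c v) \/ (forall v, B i v -> ~ union c v)).

(* The closures of V and W are disjoint. *)
Definition apart (V W : D -> Prop) : Prop :=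
  forall w, P w -> exists i, B i w /\ ((forall v, B i v -> ~ V v) \/ (forall v, B i v -> ~ W v)).

Hypothesis arith_P : arith1 M P.
Hypothesis arith_B : arith2 M B.
Hypothesis B_P : forall i x, B i x -> P x.
Hypothesis B_cover : forall x, P x -> exists i, B i x.
Hypothesis B_inter : forall i j x, B i x -> B j x ->
  exists m, B m x /\ forall y, B m y -> B i y /\ B j y.
Hypothesis B_T2 : forall x y, P x -> P y -> x <> y ->
  exists i j, B i x /\ B j y /\ ~ exists z, B i z /\ B j z.
Hypothesis B_compact : forall Q : D -> Prop, arith1 M Q ->
  (forall x, P x -> exists i, Q i /\ B i x) ->
  exists n, forall x, P x -> exists i, i < n /\ Q i /\ B i x.

(** The space is covered by basic subsets of [B i] and by basic sets missed by some neighbourhood of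
    [x]. Intersecting such neighbourhoods for the indices below the compactness bound gives [u],
    whose closure stays inside [B i]. *)
Lemma regular i x : B i x -> exists u, B u x /\
  forall w, P w -> ~ B i w -> exists m, B m w /\ forall v, B m v -> ~ B u v.
Proof.
  intros Hx.
  set (S k := exists l, B l x /\ forall v, B k v -> ~ B l v).
  destruct (B_compact (Q := fun k => (forall v, B k v -> B i v) \/ S k)) as [n Hn].
  - unfold S; arith.
  - intros y Hy. destruct (classic (B i y)) as [Hi|Hi]; [exists i; auto|].
    destruct (B_T2 (B_P Hx) Hy) as [l [k [Hl [Hk N]]]]; [intros <-; auto|].
    exists k. split; auto. right. exists l. split; auto. intros v Hv Hv'. apply N; eauto.
  - assert (K : exists u, B u x /\ forall k, k < n -> S k -> forall v, B k v -> ~ B u v).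
    { clear Hn. pattern n; apply arith_ind; clear n; [unfold S; arith | |].
      - exists i. split; auto. intros k Hk. destruct (not_lt_0 _ Hk).
      - intros n [u [Hu Hk]]. destruct (classic (S n)) as [[l [Hl Hd]]|N].
        + destruct (B_inter Hu Hl) as [m [Hm Hs]]. exists m. split; auto.
          intros k Hkn Sk v Hv Hv'. apply lt_succ in Hkn. destruct Hkn as [Hkn| ->].
          * apply (Hk k Hkn Sk v Hv), Hs, Hv'.
          * apply (Hd v Hv), Hs, Hv'.
        + exists u. split; auto. intros k Hkn Sk. apply lt_succ in Hkn.
          destruct Hkn as [Hkn| ->]; [exact (Hk k Hkn Sk) | contradiction]. }
    destruct K as [u [Hu Hk]]. exists u. split; auto. intros w Hw Hi.
    destruct (Hn w Hw) as [k [Hkn [[Q|Q] HB]]]; [destruct (Hi (Q w HB)) |].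
    exists k. split; auto. exact (Hk k Hkn Q).
Qed.

Lemma apart_sym V W : apart V W -> apart W V.
Proof. intros H w Hw. destruct (H w Hw) as [i [Hi H']]. exists i. tauto. Qed.

(** Take [u] with closure inside [B i]: points of [B i] have a neighbourhood missing [W], and all
    other points have one missing [B u]. *)
Lemma apart_add V W i x : apart V W -> B i x -> (forall v, B i v -> ~ W v) ->
  exists u, B u x /\ apart (fun v => V v \/ B u v) W.
Proof.
  intros HS Hx Hi. destruct (regular Hx) as [u [Hu Hr]]. exists u. split; auto.
  intros w Hw. destruct (classic (B i w)) as [Hiw|Hiw]; [exists i; auto|].
  destruct (Hr w Hw Hiw) as [m [Hm Hd]]. destruct (HS w Hw) as [k [Hk [H|H]]].
  - destruct (B_inter Hm Hk) as [l [Hl Hs]]. exists l. split; auto. left.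
    intros v Hv [H'|H']; destruct (Hs v Hv) as [H1 H2]; [apply (H v H2 H') | apply (Hd v H1 H')].
  - exists k; auto.
Qed.

Lemma apart_step V W z : apart V W -> P z -> exists u, B u z /\
  (apart (fun v => V v \/ B u v) W \/ apart V (fun v => W v \/ B u v)).
Proof.
  intros HS Hz. destruct (HS z Hz) as [i [Hi [H|H]]].
  - destruct (apart_add (apart_sym HS) Hi H) as [u [Hu K]]. exists u. auto using apart_sym.
  - destruct (apart_add HS Hi H) as [u [Hu K]]. exists u. auto.
Qed.

(** The start of the recursion. The Hausdorff property yields disjoint basic sets only; shrinking
    one of them makes the closures disjoint. *)
Lemma apart_basic x y : P x -> P y -> x <> y -> exists u u', B u x /\ B u' y /\ apart (B u) (B u').
Proof.
  intros Hx Hy N. destruct (B_T2 Hx Hy N) as [i [j [Hi [Hj Hd]]]].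
  destruct (@apart_add (fun _ => False) (B j) i x) as [u [Hu HS]]; auto.
  - intros w Hw. destruct (B_cover Hw) as [k Hk]. exists k. auto.
  - intros v Hv Hv'. apply Hd; eauto.
  - exists u, j. split; [|split]; auto. intros w Hw. destruct (HS w Hw) as [k [Hk [H|H]]].
    + exists k. split; auto. left. intros v Hv Hu'. apply (H v Hv). auto.
    + exists k. auto.
Qed.

Lemma apart_disjoint V W v : apart V W -> P v -> V v -> W v -> False.
Proof. intros HS Hv H1 H2. destruct (HS v Hv) as [i [Hi [H|H]]]; exact (H v Hi ltac:(assumption)). Qed.

(** ** Exhausting the space by two disjoint open sets *)

Section Separation.
Variables u0 u1 : D.
Hypothesis apart_start : apart (B u0) (B u1).

(* An element ⟨z, ⟨u, 0⟩⟩ of [c] puts the neighbourhood [B u] of z on the side of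
   [B u0], and ⟨z, ⟨u, 1⟩⟩ puts it on the side of [B u1]. *)
Definition side (u s c z v : D) : Prop :=
  B u v \/ exists z' w, z' < z /\ elem ⟨z', ⟨w, s⟩⟩ c /\ B w v.
Local Notation V := (side u0 0).
Local Notation W := (side u1 1).

Definition admissible (c z p : D) : Prop :=
  P z /\ exists u, B u z /\
    ((p = ⟨u, 0⟩ /\ apart (fun v => V c z v \/ B u v) (W c z)) \/
     (p = ⟨u, 1⟩ /\ apart (V c z) (fun v => W c z v \/ B u v))).

Definition choice (c z p : D) : Prop :=
  admissible c z p /\ forall q, admissible c z q -> p <= q.

(** A history of the recursion below [n]. Entries from [n] on are left free; as [choice] at [z]
    consults only entries before [z], two histories agree on their common domain. *)
Definition attempt (c n : D) : Prop :=
  forall z, z < n -> forall p, elem ⟨z, p⟩ c <-> choice c z p.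

Lemma arith_admissible : arith3 M admissible.
Proof. unfold admissible, apart, side. arith. Qed.

Lemma arith_choice : arith3 M choice.
Proof. unfold choice. pose proof arith_admissible. arith. Qed.

Lemma arith_attempt : arith2 M attempt.
Proof. unfold attempt. pose proof arith_choice. arith. Qed.

Lemma side_local u s c c' z :
  (forall z', z' < z -> forall p, elem ⟨z', p⟩ c <-> elem ⟨z', p⟩ c') -> side u s c z = side u s c' z.
Proof.
  intros H. apply functional_extensionality; intros v. apply propositional_extensionality.
  unfold side. split; (intros [K|[z' [w [Hz [He HB]]]]]; [now left | right]);
    exists z', w; split; auto; split; auto; apply H; auto.
Qed.

Lemma choice_local c c' z :
  (forall z', z' < z -> forall p, elem ⟨z', p⟩ c <-> elem ⟨z', p⟩ c') ->
  forall p, choice c z p <-> choice c' z p.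
Proof.
  intros H p. unfold choice, admissible.
  rewrite (side_local u0 0 H), (side_local u1 1 H). tauto.
Qed.

Lemma attempt_coherent c c' n n' : attempt c n -> attempt c' n' ->
  forall z, z < n -> z < n' -> forall p, elem ⟨z, p⟩ c <-> elem ⟨z, p⟩ c'.
Proof.
  intros Hc Hc' z. pattern z; apply (strong_ind); [arith|]. clear z.
  intros z IH Hz Hz' p. rewrite (Hc z Hz), (Hc' z Hz'). apply choice_local.
  intros z' L. apply IH; auto; eapply lt_trans; eauto.
Qed.

Lemma choice_unique c z p q : choice c z p -> choice c z q -> p = q.
Proof. intros [H1 H2] [K1 K2]. apply le_antisym; auto. Qed.

Lemma attempt_exists n : exists c, attempt c n.
Proof.
  pose proof arith_attempt. pose proof arith_choice.
  pattern n; apply arith_ind; clear n; [arith | |].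
  - exists 0. intros z Hz. destruct (not_lt_0 _ Hz).
  - intros n [c Hc].
    (* The free entries of [c] from [n] on are dropped. Uniqueness of the choice at [n] keeps [Q]
       bounded, as the coding requires. *)
    set (Q := fun q => (exists z p, q = ⟨z, p⟩ /\ z < n /\ elem q c) \/ exists p, q = ⟨n, p⟩ /\ choice c n p).
    assert (HQ : exists b, forall q, Q q -> q < b).
    { destruct (elem_lt c) as [b Hb]. destruct (classic (exists p, choice c n p)) as [[p Hp]|N].
      - destruct (ex_max b (⟨n, p⟩ + 1)) as [k [Hk1 Hk2]]. exists k.
        intros q [[z [p' [_ [_ Hq]]]]|[p' [-> Hp']]].
        + eapply lt_le_trans; [apply Hb, Hq | exact Hk1].
        + rewrite (choice_unique Hp' Hp). apply lt_succ_le, Hk2.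
      - exists b. intros q [[z [p' [_ [_ Hq]]]]|[p' [-> Hp']]]; [apply Hb, Hq | destruct N; eauto]. }
    destruct HQ as [b HQ]. destruct (@finite_coding_bounded Q b) as [c' Hc']; [unfold Q; arith | exact HQ |].
    assert (E : forall z, z < n -> forall p, elem ⟨z, p⟩ c' <-> elem ⟨z, p⟩ c).
    { intros z Hz p. rewrite Hc'. unfold Q. split.
      - intros [[z' [p' [_ [_ He]]]]|[p' [Ep _]]]; auto.
        apply pair_inj in Ep. destruct Ep as [-> _]. destruct (lt_irrefl _ Hz).
      - intros He. left. exists z, p. auto. }
    exists c'. intros z Hz p. apply lt_succ in Hz. destruct Hz as [Hz| ->].
    + rewrite E, (Hc z Hz) by auto. apply choice_local. intros z' Hz' p'. symmetry. apply E.
      eapply lt_trans; eauto.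
    + rewrite <- (choice_local (c := c)) by (intros; symmetry; auto).
      rewrite Hc'. unfold Q. split.
      * intros [[z' [p' [Ep [Hz' _]]]]|[p' [Ep Hp]]]; apply pair_inj in Ep; destruct Ep as [Ez Ep].
        { subst z'. destruct (lt_irrefl _ Hz'). }
        { now subst p'. }
      * intros Hp. right. exists p. auto.
Qed.

Lemma apart_ext (V V' W W' : D -> Prop) : (forall v, V' v -> V v) -> (forall v, W' v -> W v) ->
  apart V W -> apart V' W'.
Proof.
  intros HV HW H w Hw. destruct (H w Hw) as [i [Hi K]]. exists i. split; auto.
  destruct K as [K|K]; [left | right]; intros v Hv Hv'; apply (K v Hv); auto.
Qed.

Lemma side_succ u s c z v : side u s c (z + 1) v ->
  side u s c z v \/ exists w, elem ⟨z, ⟨w, s⟩⟩ c /\ B w v.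
Proof.
  intros [H|[z' [w [Hz [He Hv]]]]]; [now left; left|].
  apply lt_succ in Hz. destruct Hz as [Hz| ->]; [left; right | right]; eauto.
Qed.

Lemma zero_ne_one : 0 <> 1.
Proof. intros E. apply (succ_ne_0 0). now rewrite add_0_l. Qed.

Lemma choice_exists c z : apart (V c z) (W c z) -> P z -> exists p, choice c z p.
Proof.
  intros HS Hz. destruct (apart_step HS Hz) as [u [Hu K]].
  assert (A : exists p, admissible c z p).
  { destruct K as [K|K]; [exists ⟨u, 0⟩ | exists ⟨u, 1⟩]; split; auto; exists u; auto. }
  destruct A as [p Hp]. destruct (@least (admissible c z) p) as [q Hq]; auto.
  - pose proof arith_admissible. arith.
  - exists q. exact Hq.
Qed.

(** The invariant concerns closures because mere disjointness could leave the next point in the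
    closure of both sides, with no side able to absorb it. *)
Lemma attempt_apart c n : attempt c n -> forall z, z <= n -> apart (V c z) (W c z).
Proof.
  intros Hc z. pattern z; apply arith_ind; clear z; [unfold apart, side; arith | |].
  - intros _. apply apart_ext with (3 := apart_start);
      (intros v [H|[z [w [Hz _]]]]; [exact H | destruct (not_lt_0 _ Hz)]).
  - intros z IH Hz. apply lt_succ_le in Hz. specialize (IH (or_introl Hz)).
    specialize (Hc z Hz).
    destruct (classic (P z)) as [Pz|N].
    + destruct (choice_exists IH Pz) as [p Hp].
      pose proof Hp as [[_ [u [Hu [[Ep K]|[Ep K]]]]] _];
        apply apart_ext with (3 := K); intros v Hv; apply side_succ in Hv;
        (destruct Hv as [Hv|[w [He Hw]]]; [now auto|]);
        apply Hc in He; pose proof (choice_unique He Hp) as E; rewrite Ep in E;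
        apply pair_inj in E; destruct E as [E E']; subst w; auto;
        [ destruct zero_ne_one; congruence | destruct zero_ne_one; congruence ].
    + apply apart_ext with (3 := IH); intros v Hv; apply side_succ in Hv;
        (destruct Hv as [Hv|[w [He Hw]]]; [exact Hv|]); apply Hc in He; destruct N; apply He.
Qed.

Definition limit (u s v : D) : Prop := exists c n, attempt c n /\ side u s c n v.
Local Notation Vlim := (limit u0 0).
Local Notation Wlim := (limit u1 1).

Lemma side_extend u s c c' n n' v : attempt c n -> attempt c' n' -> n <= n' ->
  side u s c n v -> side u s c' n' v.
Proof.
  intros Hc Hc' Hn [H|[z [w [Hz [He Hw]]]]]; [now left | right].
  assert (Hz' : z < n') by (eapply lt_le_trans; eauto).
  exists z, w. split; auto. split; auto. now apply (attempt_coherent Hc Hc').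
Qed.

Lemma limit_disjoint v : P v -> Vlim v -> Wlim v -> False.
Proof.
  intros Hv [c [n [Hc HV]]] [c' [n' [Hc' HW]]].
  destruct (ex_max n n') as [k [Hn Hn']]. destruct (attempt_exists k) as [d Hd].
  apply (apart_disjoint (attempt_apart Hd (le_refl k)) Hv);
    [exact (side_extend Hc Hd Hn HV) | exact (side_extend Hc' Hd Hn' HW)].
Qed.

(** Points are numbers, so [v] is placed at step [v] and a history of length [v + 1] already shows
    its side. *)
Lemma limit_cover v : P v -> Vlim v \/ Wlim v.
Proof.
  intros Hv. destruct (attempt_exists (v + 1)) as [c Hc].
  destruct (@choice_exists c v) as [p Hp]; auto.
  - apply (attempt_apart Hc). left. apply lt_succ_diag.
  - assert (He : elem ⟨v, p⟩ c) by (apply (Hc v (lt_succ_diag v)), Hp).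
    destruct Hp as [[_ [u [Hu [[-> _]|[-> _]]]]] _]; [left | right]; exists c, (v + 1); split; auto;
      right; exists v, u; auto using lt_succ_diag.
Qed.

Lemma limit_open u s v : limit u s v -> exists i, B i v /\ forall w, B i w -> limit u s w.
Proof.
  intros [c [n [Hc [H|[z [w [Hz [He Hw]]]]]]]].
  - exists u. split; auto. intros w Hw. exists c, n. split; auto. now left.
  - exists w. split; auto. intros v' Hv'. exists c, n. split; auto. right. eauto.
Qed.

Lemma arith_limit : arith3 M limit.
Proof. unfold limit, side. pose proof arith_attempt. arith. Qed.

Lemma limit_basic u s v : B u v -> limit u s v.
Proof.
  intros Hv. destruct (attempt_exists 0) as [c Hc]. exists c, 0. split; auto. now left.
Qed.

Lemma separating_clopen : exists c, clopen c /\ (forall v, B u0 v -> union c v) /\ (forall v, B u1 v -> ~ union c v).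
Proof.
  pose proof arith_limit as HL.
  destruct (B_compact (Q := fun i => (forall v, B i v -> Vlim v) \/ (forall v, B i v -> Wlim v))) as [n Hn].
  - arith.
  - intros x Hx. destruct (limit_cover Hx) as [H|H]; apply limit_open in H;
      destruct H as [i [Hi K]]; exists i; auto.
  (* [c] collects the indices below the compactness bound whose basic set lies in the first limit.
     They exhaust that limit, since the remaining members of the cover lie in the other one. *)
  - destruct (@finite_coding (fun i => forall v, B i v -> Vlim v) n) as [c Hc]; [arith|].
    assert (E : forall v, P v -> (union c v <-> Vlim v)).
    { intros v Hv. split.
      - intros [i [He Hi]]. apply Hc in He. now apply He.
      - intros HV. destruct (Hn v Hv) as [i [Hin [[K|K] Hi]]].
        + exists i. split; auto. apply Hc. auto.
        + destruct (limit_disjoint Hv HV (K v Hi)). }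
    exists c. split; [|split].
    + intros w Hw. destruct (limit_cover Hw) as [H|H]; pose proof H as H'; apply limit_open in H';
        destruct H' as [i [Hi K]]; exists i; split; auto.
      * left. intros v Hv. apply E; eauto.
      * right. intros v Hv Hc'. apply E in Hc'; eauto. apply (limit_disjoint (B_P Hv)); auto.
    + intros v Hv. apply E; eauto. now apply limit_basic.
    + intros v Hv Hc'. apply E in Hc'; eauto. apply (limit_disjoint (B_P Hv) Hc'). now apply limit_basic.
Qed.

End Separation.

Lemma clopen_separation x y : P x -> P y -> x <> y -> exists c, clopen c /\ union c x /\ ~ union c y.
Proof.
  intros Hx Hy N. destruct (apart_basic Hx Hy N) as [u [u' [Hu [Hu' HS]]]].
  destruct (separating_clopen HS) as [c [Hc [H1 H2]]]. exists c. auto.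
Qed.

End Space.

(** * The order on a sequence of compact Hausdorff spaces *)

Section Family.
Variables (P : D -> D -> Prop) (B : D -> D -> D -> Prop).
Hypothesis arith_P : arith2 M P.
Hypothesis arith_B : arith3 M B.
Hypothesis B_P : forall j i x, B j i x -> P j x.
Hypothesis B_cover : forall j x, P j x -> exists i, B j i x.
Hypothesis B_inter : forall j i i' x, B j i x -> B j i' x ->
  exists m, B j m x /\ forall y, B j m y -> B j i y /\ B j i' y.
Hypothesis B_T2 : forall j x y, P j x -> P j y -> x <> y ->
  exists i i', B j i x /\ B j i' y /\ ~ exists z, B j i z /\ B j i' z.
Hypothesis B_compact : forall j (Q : D -> Prop), arith1 M Q ->
  (forall x, P j x -> exists i, Q i /\ B j i x) ->
  exists n, forall x, P j x -> exists i, i < n /\ Q i /\ B j i x.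

(** All numbers can be used as indices: one that codes no clopen set of the space gives the empty
    set and splits no piece. *)
Definition in_clopen (j c v : D) : Prop := clopen (P j) (B j) c /\ union (B j) c v.

(* The classes of this relation are the pieces of level n. *)
Definition sim (j n x y : D) : Prop :=
  forall c, c < n -> (in_clopen j c x <-> in_clopen j c y).

Definition is_least (j n m : D) : Prop :=
  P j m /\ forall w, P j w -> sim j n m w -> m <= w.

(* The pieces of level n+1 inside a piece of level n are at most two; the one
   with the numerically least point of the piece of level n comes last. *)
Definition before (j x y : D) : Prop :=
  P j x /\ P j y /\ exists n, sim j n x y /\ ~ sim j (n + 1) x y /\
    exists m, is_least j n m /\ sim j n y m /\ sim j (n + 1) y m.

Lemma arith_in_clopen : arith3 M in_clopen.
Proof. unfold in_clopen, clopen, union. arith. Qed.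

Lemma arith_before : arith3 M before.
Proof. unfold before, is_least, sim. pose proof arith_in_clopen. arith. Qed.

Lemma sim_refl j n x : sim j n x x.
Proof. intros c _. tauto. Qed.

Lemma sim_sym j n x y : sim j n x y -> sim j n y x.
Proof. intros H c Hc. specialize (H c Hc). tauto. Qed.

Lemma sim_trans j n x y z : sim j n x y -> sim j n y z -> sim j n x z.
Proof. intros H K c Hc. specialize (H c Hc). specialize (K c Hc). tauto. Qed.

Lemma nsim_sym j n x y : ~ sim j n x y -> ~ sim j n y x.
Proof. intros N H. apply N, sim_sym, H. Qed.

Lemma nsim_r j n x y z : ~ sim j n x y -> sim j n y z -> ~ sim j n x z.
Proof. intros N H K. apply N. eapply sim_trans; [exact K | apply sim_sym, H]. Qed.

Lemma nsim_l j n x y z : ~ sim j n x y -> sim j n x z -> ~ sim j n z y.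
Proof. intros N H K. apply N. eapply sim_trans; eauto. Qed.

Lemma sim_le j n n' x y : n <= n' -> sim j n' x y -> sim j n x y.
Proof. intros Hn H c Hc. apply H. eapply lt_le_trans; eauto. Qed.

Lemma sim_0 j x y : sim j 0 x y.
Proof. intros c Hc. destruct (not_lt_0 _ Hc). Qed.

(** Only membership in the clopen set of index [n] is new at level [n + 1], and this condition has
    two values. *)
Lemma sim_half j n x y z : sim j n x y -> sim j n x z ->
  ~ sim j (n + 1) x y -> ~ sim j (n + 1) x z -> sim j (n + 1) y z.
Proof.
  assert (K : forall u v, sim j n u v -> (in_clopen j n u <-> in_clopen j n v) -> sim j (n + 1) u v).
  { intros u v H E c Hc. apply lt_succ in Hc. destruct Hc as [Hc| ->]; auto. }
  intros Hy Hz Ny Nz. apply K; [eapply sim_trans; [apply sim_sym|]; eauto|].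
  destruct (classic (in_clopen j n x <-> in_clopen j n y)); [destruct Ny; auto|].
  destruct (classic (in_clopen j n x <-> in_clopen j n z)); [destruct Nz; auto|].
  tauto.
Qed.

(** * The pieces as neighbourhoods *)

Lemma sim_open j n x : P j x -> exists i, B j i x /\ forall v, B j i v -> sim j n x v.
Proof.
  intros Hx. pattern n; apply arith_ind; clear n; [unfold sim; pose proof arith_in_clopen; arith | |].
  - destruct (B_cover Hx) as [i Hi]. exists i. auto using sim_0.
  - intros n [i [Hi Hs]].
    assert (K : exists k, B j k x /\ forall v, B j k v -> (in_clopen j n x <-> in_clopen j n v)).
    { destruct (classic (clopen (P j) (B j) n)) as [Hc|N].
      - destruct (Hc x Hx) as [k [Hk H]]. exists k. split; auto. intros v Hv. unfold in_clopen.
        destruct H as [H|H]; pose proof (H x Hk); pose proof (H v Hv); tauto.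
      - exists i. split; auto. intros v _. unfold in_clopen. tauto. }
    destruct K as [k [Hk K]]. destruct (B_inter Hi Hk) as [m [Hm Hv]].
    exists m. split; auto. intros v Hmv c Hc. destruct (Hv v Hmv) as [H1 H2].
    apply lt_succ in Hc. destruct Hc as [Hc| ->]; [exact (Hs v H1 c Hc) | exact (K v H2)].
Qed.

Lemma sim_separates j x y : P j x -> P j y -> x <> y -> exists n, ~ sim j n x y.
Proof.
  intros Hx Hy N.
  destruct (@clopen_separation (P j) (B j)) with (x := x) (y := y) as [c [Hc [H1 H2]]]; eauto.
  - arith.
  - arith.
  - exists (c + 1). intros H. apply H2, (H c (lt_succ_diag c)). split; auto.
Qed.

(** Cantor's intersection argument: otherwise every point has a neighbourhood on which some [Q n]
    fails throughout; boundedly many of these cover the space, and a common level would be empty. *)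
Lemma compact_sim j (Q : D -> D -> Prop) : arith2 M Q ->
  (forall n n' x, n <= n' -> Q n' x -> Q n x) ->
  (forall n x y, P j x -> P j y -> sim j n x y -> Q n x -> Q n y) ->
  (forall n, exists x, P j x /\ Q n x) ->
  exists z, P j z /\ forall n, Q n z.
Proof.
  intros HQ Hle Hsim Hex. apply NNPP; intros N.
  set (S i n := forall v, B j i v -> ~ Q n v).
  destruct (B_compact (j := j) (Q := fun i => exists n, S i n)) as [b Hb]; [unfold S; arith | |].
  - intros x Hx.
    assert (K : exists n, ~ Q n x).
    { apply NNPP; intros K. apply N. exists x. split; auto. intros n. apply NNPP; eauto. }
    destruct K as [n Hn]. destruct (sim_open n Hx) as [i [Hi Hs]].
    exists i. split; auto. exists n. intros v Hv HQv. apply Hn. apply (Hsim n v x); eauto using sim_sym.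
  (* The second disjunct is a default that satisfies the premise of [bounding] at indices for which
     no level exists. *)
  - destruct (@bounding (fun i n => S i n \/ ~ exists n, S i n) b) as [N' HN]; [unfold S; arith | |].
    + intros i _. destruct (classic (exists n, S i n)) as [[n Hn]|K]; [exists n; auto | exists 0; auto].
    + destruct (Hex N') as [x [Hx Qx]]. destruct (Hb x Hx) as [i [Hi [Si Hix]]].
      destruct (HN i Hi) as [n [Hn [K|K]]]; [|contradiction].
      apply (K x Hix). eapply Hle; [|exact Qx]. now left.
Qed.

Lemma sim_nbhd j i x : B j i x -> exists n, forall v, P j v -> sim j n x v -> B j i v.
Proof.
  intros Hi. pose proof arith_in_clopen.
  set (S k n := forall v, B j k v -> ~ sim j n x v).
  destruct (B_compact (j := j) (Q := fun k => (forall v, B j k v -> B j i v) \/ exists n, S k n)) as [b Hb].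
  - unfold S, sim; arith.
  - intros y Hy. destruct (classic (B j i y)) as [Hiy|Hiy]; [exists i; auto|].
    destruct (@sim_separates j x y) as [n Hn]; eauto; [intros ->; auto|].
    destruct (sim_open n Hy) as [k [Hk Hs]]. exists k. split; auto. right. exists n.
    intros v Hv K. apply Hn. eapply sim_trans; [exact K | apply sim_sym; auto].
  - destruct (@bounding (fun k n => S k n \/ ~ exists n, S k n) b) as [N HN]; [unfold S, sim; arith | |].
    + intros k _. destruct (classic (exists n, S k n)) as [[n Hn]|K]; [exists n; auto | exists 0; auto].
    + exists N. intros v Hv Hs. destruct (Hb v Hv) as [k [Hk [[K|K] Hkv]]]; auto.
      destruct (HN k Hk) as [n [Hn [K'|K']]]; [|contradiction].
      destruct (K' v Hkv). eapply sim_le; [|exact Hs]. now left.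
Qed.

Lemma least_exists j n x : P j x -> exists m, is_least j n m /\ sim j n x m.
Proof.
  intros Hx. pose proof arith_in_clopen.
  destruct (@least (fun m => P j m /\ sim j n x m) x) as [m [[Hm Hs] Hl]];
    [unfold sim; arith | split; auto using sim_refl |].
  exists m. split; auto. split; auto. intros w Hw Hw'. apply Hl. split; eauto using sim_trans.
Qed.

Lemma least_unique j n m m' : is_least j n m -> is_least j n m' -> sim j n m m' -> m = m'.
Proof.
  intros [H1 H2] [K1 K2] H. apply le_antisym; auto using sim_sym.
Qed.

Lemma least_le j n n' m : n <= n' -> is_least j n m -> is_least j n' m.
Proof. intros Hn [H1 H2]. split; auto. intros w Hw Hs. apply H2; auto. eapply sim_le; eauto. Qed.

(** Only the numbers below [z] compete with it; [bounding] gives a level at which all of them that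
    are points have been separated from [z]. *)
Lemma eventually_least j z : P j z -> exists n, is_least j n z.
Proof.
  intros Hz. pose proof arith_in_clopen.
  destruct (@bounding (fun w n => P j w -> ~ sim j n z w) z) as [N HN]; [unfold sim; arith | |].
  - intros w Hw. destruct (classic (P j w)) as [Pw|N]; [|exists 0; tauto].
    destruct (@sim_separates j z w) as [n Hn]; eauto. intros ->. destruct (lt_irrefl _ Hw).
  - exists N. split; auto. intros w Pw Hs. apply not_lt. intros L.
    destruct (HN w L) as [n [Hn K]]. apply K; auto. eapply sim_le; [|exact Hs]. now left.
Qed.

Lemma split_level j x y : P j x -> P j y -> x <> y ->
  exists n, sim j n x y /\ ~ sim j (n + 1) x y.
Proof.
  intros Hx Hy N. pose proof arith_in_clopen. destruct (sim_separates Hx Hy N) as [k Hk].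
  destruct (@least (fun n => ~ sim j n x y) k) as [n [Hn Hl]]; [unfold sim; arith | auto |].
  destruct (zero_or_succ n) as [->|[n' ->]]; [destruct Hn; apply sim_0|].
  exists n'. split; auto. apply NNPP; intros K. apply Hl in K.
  apply (lt_irrefl n'). apply lt_succ_le, K.
Qed.

(** * The well-order on a single space *)

Lemma before_irrefl j x : ~ before j x x.
Proof. intros [_ [_ [n [_ [N _]]]]]. apply N, sim_refl. Qed.

Lemma before_total j x y : P j x -> P j y -> x <> y -> before j x y \/ before j y x.
Proof.
  intros Hx Hy N. destruct (split_level Hx Hy N) as [n [Hs Hn]].
  destruct (least_exists n Hy) as [m [Hm Hym]].
  destruct (classic (sim j (n + 1) y m)) as [K|K].
  - left. split; auto. split; auto. exists n. split; auto. split; auto. exists m. auto.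
  - right. split; auto. split; auto. exists n. split; auto using sim_sym. split; [auto using sim_sym|].
    exists m. split; auto. split; [eauto using sim_trans|].
    apply sim_half with y; auto using sim_sym.
Qed.

Lemma level_cases j n x y k : sim j n x y -> ~ sim j k x y -> n + 1 <= k.
Proof.
  intros H N. destruct (le_or_lt k n) as [L|L]; [destruct N; eapply sim_le; eauto | now apply lt_succ_le].
Qed.

(** The comparison is made at the level where [x] and [y] part, which is below [k], so it sees only
    their pieces of level [k]. Together with [before_sim_l] this makes the pieces convex. *)
Lemma before_sim_r j k x y y' : before j x y -> P j y' -> ~ sim j k x y -> sim j k y y' -> before j x y'.
Proof.
  intros [Hx [Hy [n [Hs [Hn [m [Hm [H1 H2]]]]]]]] Hy' N K.
  pose proof (level_cases Hs N) as L. pose proof (sim_le L K) as K'.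
  assert (L' : n <= n + 1) by (left; apply lt_succ_diag). pose proof (sim_le L' K') as K''.
  split; auto. split; auto. exists n. split; [eauto using sim_trans|].
  split; [eapply nsim_r; eauto|]. exists m. split; auto. split; eapply sim_trans; [apply sim_sym| |apply sim_sym|]; eauto.
Qed.

Lemma before_sim_l j k x x' y : before j x y -> P j x' -> ~ sim j k x y -> sim j k x x' -> before j x' y.
Proof.
  intros [Hx [Hy [n [Hs [Hn [m [Hm [H1 H2]]]]]]]] Hx' N K.
  pose proof (level_cases Hs N) as L. pose proof (sim_le L K) as K'.
  assert (L' : n <= n + 1) by (left; apply lt_succ_diag). pose proof (sim_le L' K') as K''.
  split; auto. split; auto. exists n. split; [eauto using sim_trans, sim_sym|].
  split; [eapply nsim_l; eauto|]. exists m. auto.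
Qed.

(** If the two pairs part at different levels, one point can be replaced inside its piece. At the
    same level, [y] and [z] would both lie in the half of the same least point, although that level
    separates them. *)
Lemma before_trans j x y z : before j x y -> before j y z -> before j x z.
Proof.
  intros Hxy Hyz. pose proof Hxy as [Hx [Hy [n [Hs [Hn [m [Hm [Hym Hym']]]]]]]].
  pose proof Hyz as [_ [Hz [n' [Hs' [Hn' [m' [Hm' [Hzm Hzm']]]]]]]].
  destruct (classic (sim j (n + 1) y z)) as [K|K]; [exact (before_sim_r Hxy Hz Hn K)|].
  destruct (classic (sim j (n' + 1) x y)) as [K'|K']; [exact (before_sim_l Hyz Hx Hn' (sim_sym K'))|].
  assert (E : n = n').
  { pose proof (level_cases Hs K'). pose proof (level_cases Hs' K).
    apply le_antisym; apply lt_succ; now apply lt_succ_le. }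
  subst n'. assert (E : m = m').
  { apply (least_unique Hm Hm'). eauto using sim_trans, sim_sym. }
  subst m'. destruct Hn'. eauto using sim_trans, sim_sym.
Qed.

(** Where [w] and [m] part, [m] is still the least point of its piece, so its half is the right
    one. *)
Lemma least_is_last j n m w : is_least j n m -> P j w -> sim j n m w -> w <> m -> before j w m.
Proof.
  intros Hm Hw Hs N. destruct (split_level Hw (proj1 Hm) N) as [k [Hk Hk']].
  split; auto. split; [apply Hm|]. exists k. split; auto. split; auto.
  exists m. split; [|split; apply sim_refl]. apply least_le with n; auto.
  pose proof (level_cases (sim_sym Hs) Hk'). apply lt_succ. now apply lt_succ_le.
Qed.

(* The leftmost branch of pieces meeting S converges to the minimum of S. *)
Lemma before_wf j (S : D -> Prop) s : arith1 M S -> (forall x, S x -> P j x) -> S s ->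
  exists x, S x /\ forall y, S y -> y <> x -> before j x y.
Proof.
  intros HS HP Hs0. pose proof arith_in_clopen. pose proof arith_before.
  (* [Q n] describes the piece of level [n] on the leftmost branch: it meets [S], and all of [S]
     outside it lies to its right. *)
  set (Q n x := (exists s, S s /\ sim j n x s) /\ forall y, S y -> ~ sim j n x y -> before j x y).
  destruct (@compact_sim j Q) as [z [Hz HQ]].
  - unfold Q, sim; arith.
  - intros n n' x Hn [[y [Hy Hxy]] Hl]. split; [exists y; eauto using sim_le|].
    intros w Hw N. apply Hl; auto. intros K. apply N. eapply sim_le; eauto.
  - intros n x y Hx Hy Hxy [[w [Hw Hxw]] Hl]. split; [exists w; eauto using sim_trans, sim_sym|].
    intros v Hv N. assert (K : ~ sim j n x v) by (eapply nsim_l; eauto using sim_sym).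
    eapply before_sim_l; eauto.
  - intros n. pattern n; apply arith_ind; clear n; [unfold Q, sim; arith | |].
    + exists s. split; auto. split; [exists s; auto using sim_refl|]. intros y _ N. destruct N. apply sim_0.
    + intros n [x [Hx [[y [Hy Hxy]] Hl]]]. destruct (least_exists n Hx) as [m [Hm Hxm]].
      assert (Hl' : forall y', S y' -> sim j n x y' -> forall w, S w -> ~ sim j n y' w -> before j y' w).
      { intros y' Hy' K w Hw N. assert (K' : ~ sim j n x w) by (eapply nsim_l; eauto using sim_sym).
        eapply before_sim_l; eauto. }
      (* The half without [m] is the left one, so the branch enters it if it meets [S]; otherwise
         all of [S] in this piece lies in the half of [m]. *)
      destruct (classic (exists y', S y' /\ sim j n x y' /\ ~ sim j (n + 1) y' m)) as [[y' [Hy' [K K']]]|N].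
      * exists y'. split; auto. split; [exists y'; auto using sim_refl|].
        intros w Hw Nw. destruct (classic (sim j n y' w)) as [L|L]; [|eauto].
        split; auto. split; auto. exists n. split; auto. split; auto. exists m.
        split; auto. split; [eauto using sim_trans, sim_sym|].
        apply sim_half with y'; eauto using sim_trans, sim_sym.
      * exists y. split; auto. split; [exists y; auto using sim_refl|].
        intros w Hw Nw. destruct (classic (sim j n y w)) as [L|L]; [|eauto].
        destruct Nw. apply sim_trans with m; [|apply sim_sym]; apply NNPP; intros K;
          apply N; eauto using sim_trans.
  (* If [z] were not in [S], it would be the last element of a piece containing some [y] of [S], so
     [y] would come before [z]; but at a level separating them [Q] puts [z] before [y]. *)
  - assert (HSz : S z).
    { apply NNPP; intros N. destruct (eventually_least Hz) as [n Hn].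
      destruct (HQ n) as [[y [Hy Hzy]] _]. assert (E : y <> z) by (intros ->; auto).
      destruct (sim_separates Hz (HP _ Hy) (not_eq_sym E)) as [k Hk].
      apply (before_irrefl (j := j) (x := z)). eapply before_trans; [apply (proj2 (HQ k) y); auto|].
      eapply least_is_last; eauto. }
    exists z. split; auto. intros y Hy N.
    destruct (sim_separates Hz (HP _ Hy) (not_eq_sym N)) as [k Hk]. exact (proj2 (HQ k) y Hy Hk).
Qed.

(** Induction on the level. If [x] falls into the right half of a split piece, the left half is
    adjacent and its numerically least point, being its last, is [a]. Otherwise nothing new appears
    on the left and the former answer stands. *)
Lemma piece_left j n x : P j x ->
  (forall y, P j y -> ~ sim j n x y -> before j x y) \/
  exists a, before j a x /\ forall y, before j a y -> ~ before j x y -> sim j n x y.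
Proof.
  intros Hx. pose proof arith_in_clopen. pose proof arith_before.
  pattern n; apply arith_ind; clear n; [unfold sim; arith | |].
  - left. intros y _ N. destruct N. apply sim_0.
  - intros n IH. destruct (least_exists n Hx) as [m [Hm Hxm]].
    assert (L : n <= n + 1) by (left; apply lt_succ_diag).
    destruct (classic (sim j (n + 1) x m /\ exists l, P j l /\ sim j n x l /\ ~ sim j (n + 1) x l))
      as [[K [l [Hl [Hxl Nl]]]]|N].
    + right. destruct (least_exists (n + 1) Hl) as [a [Ha Hla]]. exists a.
      pose proof (sim_le L Hla) as Hla'.
      assert (Na : ~ sim j (n + 1) x a) by (eapply nsim_r; eauto).
      assert (Hax : before j a x).
      { split; [apply Ha|]. split; auto. exists n. split; [eauto using sim_trans, sim_sym|].
        split; [now apply nsim_sym|]. exists m. auto. }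
      split; auto. intros y Hay Nxy. apply NNPP; intros Nsim. pose proof (proj1 (proj2 Hay)) as Hy.
      assert (Hyx : before j y x).
      { destruct (@before_total j x y); auto; [|contradiction]. intros <-. apply Nsim, sim_refl. }
      apply (before_irrefl (j := j) (x := a)). apply before_trans with y; auto.
      destruct (classic (sim j n x y)) as [Hxy|Hxy].
      * assert (Hya : sim j (n + 1) a y).
        { apply sim_half with x; eauto using sim_trans. }
        apply least_is_last with (n + 1); auto. intros ->. exact (before_irrefl Hay).
      * apply (before_sim_r (k := n) Hyx (proj1 Ha)); [now apply nsim_sym | eauto using sim_trans].
    + assert (Hr : forall y, P j y -> sim j n x y -> ~ sim j (n + 1) x y -> before j x y).
      { intros y Hy Hxy Ny. split; auto. split; auto. exists n. split; auto. split; auto.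
        exists m. split; auto. split; [eauto using sim_trans, sim_sym|].
        apply sim_half with x; auto. intros K. apply N. eauto. }
      destruct IH as [IH|[a [Hax IH]]]; [left | right].
      * intros y Hy Ny. destruct (classic (sim j n x y)); auto.
      * exists a. split; auto. intros y Hay Nxy. apply NNPP; intros Ny. apply Nxy, Hr; auto. apply Hay.
Qed.

(** * The disjoint sum as an order *)

Definition point (z : D) : Prop := exists j x, z = ⟨j, x⟩ /\ P j x.

Definition precedes (z w : D) : Prop :=
  exists j x k y, z = ⟨j, x⟩ /\ w = ⟨k, y⟩ /\ P j x /\ P k y /\ (j < k \/ j = k /\ before j x y).

Definition near (n z w : D) : Prop :=
  exists j x y, z = ⟨j, x⟩ /\ w = ⟨j, y⟩ /\ P j x /\ P j y /\ sim j n x y.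

Lemma precedes_pair j x k y : precedes ⟨j, x⟩ ⟨k, y⟩ <->
  P j x /\ P k y /\ (j < k \/ j = k /\ before j x y).
Proof.
  split; [|intros H; exists j, x, k, y; auto].
  intros [j' [x' [k' [y' [E [E' H]]]]]]. apply pair_inj in E, E'.
  destruct E as [-> ->], E' as [-> ->]. exact H.
Qed.

Lemma near_pair n j x k y : near n ⟨j, x⟩ ⟨k, y⟩ <-> j = k /\ P j x /\ P j y /\ sim j n x y.
Proof.
  split; [|intros [<- H]; exists j, x, y; auto].
  intros [j' [x' [y' [E [E' H]]]]]. apply pair_inj in E, E'.
  destruct E as [-> ->], E' as [-> ->]. auto.
Qed.

Lemma arith_point : arith1 M point.
Proof. unfold point. arith. Qed.

Lemma arith_precedes : arith2 M precedes.
Proof. unfold precedes. pose proof arith_before. arith. Qed.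

Lemma precedes_point z w : precedes z w -> point z /\ point w.
Proof. intros [j [x [k [y [-> [-> [Hx [Hy _]]]]]]]]. split; [exists j, x | exists k, y]; auto. Qed.

Lemma near_point n z w : near n z w -> point w.
Proof. intros [j [x [y [-> [-> [Hx [Hy _]]]]]]]. exists j, y; auto. Qed.

Lemma near_le n n' z w : n <= n' -> near n' z w -> near n z w.
Proof.
  intros Hn [j [x [y [-> [-> [Hx [Hy Hs]]]]]]]. apply near_pair. eauto using sim_le.
Qed.

Lemma precedes_irrefl z : ~ precedes z z.
Proof.
  intros H. destruct (proj1 (precedes_point H)) as [j [x [-> Hx]]]. apply precedes_pair in H.
  destruct H as [_ [_ [H|[_ H]]]]; [exact (lt_irrefl _ H) | exact (before_irrefl H)].
Qed.

Lemma precedes_trans a b c : precedes a b -> precedes b c -> precedes a c.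
Proof.
  intros [j [x [k [y [-> [-> [Hx [Hy H]]]]]]]] K.
  destruct (proj2 (precedes_point K)) as [l [z [-> Hz]]].
  apply precedes_pair in K. apply precedes_pair. split; auto. split; auto.
  destruct K as [_ [_ [K|[<- K]]]], H as [H|[<- H]]; eauto using lt_trans, before_trans.
Qed.

Lemma precedes_total z w : point z -> point w -> precedes z w \/ z = w \/ precedes w z.
Proof.
  intros [j [x [-> Hx]]] [k [y [-> Hy]]]. rewrite !precedes_pair.
  destruct (lt_trichotomy j k) as [H|[<-|H]]; auto 9.
  destruct (classic (x = y)) as [<-|N]; auto.
  destruct (before_total Hx Hy N); auto 9.
Qed.

Lemma precedes_wf (S : D -> Prop) s : arith1 M S -> (forall x, S x -> point x) -> S s ->
  exists x, S x /\ forall y, S y -> y = x \/ precedes x y.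
Proof.
  intros HS HP Hs. destruct (HP s Hs) as [j0 [x0 [-> _]]].
  destruct (@least (fun j => exists x, S ⟨j, x⟩) j0) as [j [[x1 Hx1] Hj]]; [arith | eauto |].
  assert (HPj : forall x, S ⟨j, x⟩ -> P j x).
  { intros x Hx. destruct (HP _ Hx) as [j' [x' [E HP']]]. apply pair_inj in E.
    destruct E as [-> ->]. exact HP'. }
  destruct (@before_wf j (fun x => S ⟨j, x⟩) x1) as [x [Hx Hl]]; auto; [arith|].
  exists ⟨j, x⟩. split; auto. intros w Hw. destruct (HP w Hw) as [k [y [-> Hy]]].
  rewrite precedes_pair. destruct (Hj k (ex_intro _ y Hw)) as [L|<-]; auto.
  destruct (classic (y = x)) as [->|N]; auto 8.
Qed.

Lemma precedes_near_r a z : precedes a z -> exists n, forall w, near n z w -> precedes a w.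
Proof.
  intros [j [x [k [y [-> [-> [Hx [Hy [H|[<- H]]]]]]]]]].
  - exists 0. intros w [k' [y' [v [E [-> [_ [Hv _]]]]]]]. apply pair_inj in E. destruct E as [<- <-].
    apply precedes_pair. auto.
  - destruct (@sim_separates j x y) as [n Hn]; auto; [intros <-; exact (before_irrefl H)|].
    exists n. intros w [k' [y' [v [E [-> [_ [Hv Hs]]]]]]]. apply pair_inj in E. destruct E as [<- <-].
    apply precedes_pair. eauto 9 using before_sim_r.
Qed.

Lemma precedes_near_l z b : precedes z b -> exists n, forall w, near n z w -> precedes w b.
Proof.
  intros [j [x [k [y [-> [-> [Hx [Hy [H|[<- H]]]]]]]]]].
  - exists 0. intros w [k' [y' [v [E [-> [_ [Hv _]]]]]]]. apply pair_inj in E. destruct E as [<- <-].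
    apply precedes_pair. auto.
  - destruct (@sim_separates j x y) as [n Hn]; auto; [intros <-; exact (before_irrefl H)|].
    exists n. intros w [k' [y' [v [E [-> [_ [Hv Hs]]]]]]]. apply pair_inj in E. destruct E as [<- <-].
    apply precedes_pair. eauto 9 using before_sim_l.
Qed.

(** If the piece reaches the left end of its summand, the left endpoint comes from the last nonempty
    summand before it, found by [greatest]. That summand is a single piece of level 0, so its
    numerically least point is its last. *)
Lemma near_left n z : point z ->
  (forall y, point y -> ~ precedes z y -> near n z y) \/
  exists a, precedes a z /\ forall y, precedes a y -> ~ precedes z y -> near n z y.
Proof.
  intros [j [x [-> Hx]]].
  assert (Hj : forall k y, P k y -> ~ precedes ⟨j, x⟩ ⟨k, y⟩ -> j <= k -> j = k /\ ~ before j x y).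
  { intros k y Hy N L. rewrite precedes_pair in N. destruct L as [L|<-]; [destruct N; auto|].
    split; auto. intros H. apply N. auto 9. }
  destruct (piece_left n Hx) as [H|[a [Ha H]]].
  - assert (Hn : forall k y, P k y -> ~ precedes ⟨j, x⟩ ⟨k, y⟩ -> j <= k -> near n ⟨j, x⟩ ⟨k, y⟩).
    { intros k y Hy N L. destruct (Hj k y Hy N L) as [<- N']. apply near_pair.
      split; auto. split; auto. split; auto. apply NNPP; intros Ns. apply N', H; auto. }
    destruct (classic (exists k y, k < j /\ P k y)) as [[k0 [y0 [Hk0 Hy0]]]|N].
    + destruct (@greatest (fun k => k < j /\ exists y, P k y) k0 j) as [k [[Hk [y Hy]] Hg]].
      * arith.
      * eauto.
      * intros k [Hk _]. now left.
      * right. destruct (least_exists 0 Hy) as [m [Hm _]]. exists ⟨k, m⟩.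
        split; [apply precedes_pair; split; [apply Hm | auto]|].
        intros w Hw Nw. destruct (proj2 (precedes_point Hw)) as [l [v [-> Hv]]].
        apply Hn; auto. apply not_lt. intros Hl. apply precedes_pair in Hw.
        destruct Hw as [_ [_ [L|[<- L]]]].
        { apply (lt_irrefl k). eapply lt_le_trans; [exact L | apply Hg; eauto]. }
        { apply (before_irrefl (j := k) (x := m)). apply before_trans with v; auto.
          apply least_is_last with 0; auto using sim_0. intros ->. exact (before_irrefl L). }
    + left. intros w [k [y [-> Hy]]] Nw. apply Hn; auto. apply not_lt. intros L. apply N. eauto.
  - right. exists ⟨j, a⟩. pose proof (proj1 Ha) as Pa. split; [apply precedes_pair; auto 9|].
    intros w Hw Nw. destruct (proj2 (precedes_point Hw)) as [k [y [-> Hy]]].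
    apply precedes_pair in Hw. destruct Hw as [_ [_ Hw]].
    destruct (Hj k y Hy Nw) as [<- N]; [destruct Hw as [Hw|[Hw _]]; [left | right]; auto|].
    destruct Hw as [Hw|[_ Hw]]; [destruct (lt_irrefl _ Hw)|].
    apply near_pair. auto 9.
Qed.

(** Well-foundedness gives the least element above [b]. An open interval ending there contains
    nothing above [b], which serves both for small open intervals and for the openness of upper
    closed ones. *)
Lemma successor b : point b ->
  (forall y, point y -> y = b \/ precedes y b) \/
  exists c, precedes b c /\ forall y, precedes y c -> y = b \/ precedes y b.
Proof.
  intros Hb. pose proof arith_precedes.
  destruct (classic (exists c, precedes b c)) as [[c Hc]|N].
  - right. destruct (@precedes_wf (precedes b) c) as [d [Hd Hl]]; auto; [arith | apply precedes_point|].
    exists d. split; auto. intros y Hy.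
    destruct (precedes_total Hb (proj1 (precedes_point Hy))) as [K|[K|K]]; auto.
    destruct (Hl y K) as [->|K']; [destruct (precedes_irrefl Hy)|].
    destruct (precedes_irrefl (precedes_trans K' Hy)).
  - left. intros y Hy. destruct (precedes_total Hb Hy) as [K|[K|K]]; auto. destruct N; eauto.
Qed.

(** * Topologies generated by the pieces *)

(** [T] is a basis of the topology whose neighbourhoods are the pieces. Two such families are
    compared through the pieces, so the identity is continuous both ways. *)
Definition generates (T : D -> D -> Prop) : Prop :=
  (forall i z, T i z -> point z /\ exists n, forall w, near n z w -> T i w) /\
  (forall z n, point z -> exists i, T i z /\ forall w, T i w -> near n z w).

Definition sum_basis (p z : D) : Prop := exists j i x, p = ⟨j, i⟩ /\ z = ⟨j, x⟩ /\ B j i x.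

Lemma sum_basis_generates : generates sum_basis.
Proof.
  split.
  - intros p z [j [i [x [-> [-> Hi]]]]]. split; [exists j, x; eauto|].
    destruct (sim_nbhd Hi) as [n Hn]. exists n. intros w [j' [x' [v [E [-> [_ [Hv Hs]]]]]]].
    apply pair_inj in E. destruct E as [<- <-]. exists j, i, v. auto.
  - intros z n [j [x [-> Hx]]]. destruct (sim_open n Hx) as [i [Hi Hs]].
    exists ⟨j, i⟩. split; [exists j, i, x; auto|].
    intros w [j' [i' [v [E [-> Hv]]]]]. apply pair_inj in E. destruct E as [<- <-].
    apply near_pair. eauto 9.
Qed.

Section Order.
Variables L R : sets M.
Hypothesis mem_L : forall z, mem M z L <-> point z.
Hypothesis mem_R : forall p, mem M p R <-> exists z w, p = ⟨z, w⟩ /\ precedes z w.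

Lemma mem_R_pair z w : mem M ⟨z, w⟩ R <-> precedes z w.
Proof.
  rewrite mem_R. split; eauto. intros [z' [w' [E H]]]. apply pair_inj in E.
  destruct E as [-> ->]. exact H.
Qed.

Definition open_basis (i x : D) : Prop :=
  exists a b, i = ⟨a, b⟩ /\ mem M x L /\
    (a = 0 \/ exists u, a = u + 1 /\ mem M ⟨u, x⟩ R) /\
    (b = 0 \/ exists v, b = v + 1 /\ mem M ⟨x, v⟩ R).

Definition upper_basis (p x : D) : Prop :=
  exists i, (p = ⟨0, i⟩ /\ open_basis i x) \/
    (p = ⟨1, i⟩ /\ exists a b, i = ⟨a, b⟩ /\ mem M a L /\ mem M b L /\
      mem M ⟨a, x⟩ R /\ (mem M ⟨x, b⟩ R \/ x = b)).

Lemma near_both n n' (A A' : D -> Prop) z :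
  (forall w, near n z w -> A w) -> (forall w, near n' z w -> A' w) ->
  exists k, forall w, near k z w -> A w /\ A' w.
Proof.
  intros H H'. destruct (ex_max n n') as [k [Hk Hk']]. exists k.
  intros w Hw. split; [apply H, (near_le Hk Hw) | apply H', (near_le Hk' Hw)].
Qed.

Lemma open_basis_near i z : open_basis i z -> exists n, forall w, near n z w -> open_basis i w.
Proof.
  intros [a [b [-> [Hz [Ha Hb]]]]].
  assert (Ka : exists n, forall w, near n z w -> a = 0 \/ exists u, a = u + 1 /\ mem M ⟨u, w⟩ R).
  { destruct Ha as [->|[u [-> Hu]]]; [exists 0; auto|]. apply mem_R_pair in Hu.
    destruct (precedes_near_r Hu) as [n Hn]. exists n. intros w Hw. right. exists u.
    rewrite mem_R_pair. auto. }
  assert (Kb : exists n, forall w, near n z w -> b = 0 \/ exists v, b = v + 1 /\ mem M ⟨w, v⟩ R).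
  { destruct Hb as [->|[v [-> Hv]]]; [exists 0; auto|]. apply mem_R_pair in Hv.
    destruct (precedes_near_l Hv) as [n Hn]. exists n. intros w Hw. right. exists v.
    rewrite mem_R_pair. auto. }
  destruct Ka as [n Hn], Kb as [n' Hn']. destruct (near_both Hn Hn') as [k Hk].
  exists k. intros w Hw. exists a, b. split; auto. split; auto. apply mem_L. eapply near_point; eauto.
Qed.

(** The left endpoint comes from [near_left] and the right one is the successor of [z], each
    infinite if missing. Since the interval stops at [z], the right end of the piece does not
    matter. *)
Lemma open_basis_inside z n : point z -> exists i, open_basis i z /\ forall w, open_basis i w -> near n z w.
Proof.
  intros Hz.
  assert (Ka : exists a, (a = 0 \/ exists u, a = u + 1 /\ mem M ⟨u, z⟩ R) /\
    forall w, point w -> (a = 0 \/ exists u, a = u + 1 /\ mem M ⟨u, w⟩ R) -> ~ precedes z w -> near n z w).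
  { destruct (near_left n Hz) as [H|[a [Ha H]]].
    - exists 0. auto.
    - exists (a + 1). split; [right; exists a; rewrite mem_R_pair; auto|].
      intros w Hw [E|[u [E Hu]]]; [destruct (succ_ne_0 _ E)|].
      apply succ_inj in E. subst u. apply mem_R_pair in Hu. auto. }
  assert (Kb : exists b, (b = 0 \/ exists v, b = v + 1 /\ mem M ⟨z, v⟩ R) /\
    forall w, point w -> (b = 0 \/ exists v, b = v + 1 /\ mem M ⟨w, v⟩ R) -> ~ precedes z w).
  { assert (N : forall w, w = z \/ precedes w z -> ~ precedes z w).
    { intros w [->|H] K; [exact (precedes_irrefl K) | exact (precedes_irrefl (precedes_trans H K))]. }
    destruct (successor Hz) as [H|[b [Hb H]]].
    - exists 0. auto.
    - exists (b + 1). split; [right; exists b; rewrite mem_R_pair; auto|].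
      intros w Hw [E|[v [E Hv]]]; [destruct (succ_ne_0 _ E)|].
      apply succ_inj in E. subst v. apply mem_R_pair in Hv. auto. }
  destruct Ka as [a [Ha Ka]], Kb as [b [Hb Kb]]. exists ⟨a, b⟩. split.
  - exists a, b. rewrite mem_L. auto.
  - intros w [a' [b' [E [Hw [Ha' Hb']]]]]. apply pair_inj in E. destruct E as [<- <-].
    apply mem_L in Hw. auto.
Qed.

Lemma open_basis_generates : generates open_basis.
Proof.
  split; [|exact open_basis_inside]. intros i z H. split; [|now apply open_basis_near].
  destruct H as [a [b [_ [Hz _]]]]. now apply mem_L.
Qed.

Lemma upper_basis_generates : generates upper_basis.
Proof.
  split.
  - intros p z [i [[-> H]|[-> [a [b [-> [Ha [Hb [Haz Hzb]]]]]]]]].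
    + split; [apply open_basis_generates in H; apply H|].
      destruct (open_basis_near H) as [n Hn]. exists n. intros w Hw. exists i. auto.
    + apply mem_R_pair in Haz. rewrite mem_R_pair in Hzb. split; [apply (precedes_point Haz)|].
      (* Being at most [b] means being below the successor of [b], an open condition, or is always
         true if [b] is the last element. *)
      assert (K : exists n, forall w, near n z w -> w = b \/ precedes w b).
      { apply mem_L in Hb. destruct (successor Hb) as [H|[c [Hc H]]].
        - exists 0. intros w Hw. apply H. eapply near_point; eauto.
        - assert (Hzc : precedes z c) by (destruct Hzb as [K| ->]; eauto using precedes_trans).
          destruct (precedes_near_l Hzc) as [n Hn]. exists n. auto. }
      destruct K as [n Hn], (precedes_near_r Haz) as [n' Hn'].
      destruct (near_both Hn Hn') as [k Hk]. exists k. intros w Hw.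
      destruct (Hk w Hw) as [K K']. exists ⟨a, b⟩. right. split; auto. exists a, b.
      rewrite !mem_R_pair. tauto.
  - intros z n Hz. destruct (open_basis_inside n Hz) as [i [Hi Hn]]. exists ⟨0, i⟩.
    split; [exists i; auto|]. intros w [i' [[E H]|[E _]]]; apply pair_inj in E; destruct E as [E E'].
    + subst i'. auto.
    + destruct (zero_ne_one E).
Qed.
End Order.

(** * Reading the statement in a model *)

Definition csc (pt : D -> Prop) (bs : D -> D -> Prop) (int : D -> D -> D -> D -> Prop) : Prop :=
  (forall i x, bs i x -> pt x) /\
  (forall x, pt x -> exists i, bs i x) /\
  (forall x i j m, int x i j m -> pt x) /\
  (forall x i j m n, int x i j m /\ int x i j n -> m = n) /\
  (forall x i j, bs i x /\ bs j x ->
     exists m, int x i j m /\ bs m x /\ forall y, bs m y -> bs i y /\ bs j y).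

Definition hausdorff (pt : D -> Prop) (bs : D -> D -> Prop) : Prop :=
  forall x y, pt x /\ pt y /\ x <> y ->
    exists i j, bs i x /\ bs j y /\ ~ exists z, bs i z /\ bs j z.

Definition cover (pt : D -> Prop) (bs : D -> D -> Prop) (I : sets M) : Prop :=
  forall x, pt x <-> exists i, mem M i I /\ bs i x.

Definition compact_space (pt : D -> Prop) (bs : D -> D -> Prop) : Prop :=
  forall I, cover pt bs I -> exists A, (exists n, forall i, mem M i A -> i < n) /\
    (forall i, mem M i A -> mem M i I) /\ cover pt bs A.

Definition homeo (pt : D -> Prop) (bs : D -> D -> Prop) (pt' : D -> Prop) (bs' : D -> D -> Prop) : Prop :=
  exists f : sets M,
    ((forall z, mem M z f -> exists x y, z = ⟨x, y⟩ /\ pt x /\ pt' y) /\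
     (forall x, pt x -> exists y, mem M ⟨x, y⟩ f) /\
     (forall x y y', mem M ⟨x, y⟩ f /\ mem M ⟨x, y'⟩ f -> y = y')) /\
    ((forall x x' y, mem M ⟨x, y⟩ f /\ mem M ⟨x', y⟩ f -> x = x') /\
     (forall y, pt' y -> exists x, mem M ⟨x, y⟩ f)) /\
    (forall x y j, mem M ⟨x, y⟩ f /\ bs' j y ->
       exists i, bs i x /\ forall x' y', bs i x' /\ mem M ⟨x', y'⟩ f -> bs' j y') /\
    (forall x y i, mem M ⟨x, y⟩ f /\ bs i x ->
       exists j, bs' j y /\ forall x' y', bs' j y' /\ mem M ⟨x', y'⟩ f -> bs i x').

Definition wellorder (L R : sets M) : Prop :=
  ((forall z, mem M z R -> exists x y, z = ⟨x, y⟩ /\ mem M x L /\ mem M y L) /\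
   (forall x, ~ mem M ⟨x, x⟩ R) /\
   (forall x y z, mem M ⟨x, y⟩ R /\ mem M ⟨y, z⟩ R -> mem M ⟨x, z⟩ R) /\
   (forall x y, mem M x L /\ mem M y L -> mem M ⟨x, y⟩ R \/ x = y \/ mem M ⟨y, x⟩ R)) /\
  ~ (exists f : sets M,
       ((forall z, mem M z f -> exists n x, z = ⟨n, x⟩ /\ mem M x L) /\
        (forall n, exists x, mem M ⟨n, x⟩ f) /\
        (forall n x y, mem M ⟨n, x⟩ f /\ mem M ⟨n, y⟩ f -> x = y)) /\
       forall n x y, mem M ⟨n, x⟩ f /\ mem M ⟨n + 1, y⟩ f -> mem M ⟨y, x⟩ R).

Lemma sum_homeo (L : sets M) T : (forall z, mem M z L <-> point z) -> generates T ->
  homeo point sum_basis (fun z => mem M z L) T.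
Proof.
  intros HL HT. pose proof arith_point.
  destruct (@comprehension1 (fun p => exists z, p = ⟨z, z⟩ /\ point z)) as [f Hf]; [arith|].
  assert (Hfp : forall x y, mem M ⟨x, y⟩ f <-> x = y /\ point x).
  { intros x y. rewrite Hf. split; [|intros [<- Hx]; eauto].
    intros [z [E Hz]]. apply pair_inj in E. destruct E as [-> ->]. auto. }
  assert (K : forall T T', generates T -> generates T' -> forall x j, T' j x ->
    exists i, T i x /\ forall w, T i w -> T' j w).
  { intros U U' [_ H1] [H2 _] x j Hj. destruct (H2 j x Hj) as [Hx [n Hn]].
    destruct (H1 x n Hx) as [i [Hi Hs]]. eauto. }
  exists f. repeat split.
  - intros z Hz. apply Hf in Hz. destruct Hz as [x [-> Hx]]. exists x, x. rewrite HL. auto.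
  - intros x Hx. exists x. apply Hfp. auto.
  - intros x y y' [H1 H2]. apply Hfp in H1, H2. destruct H1 as [<- _], H2 as [<- _]. auto.
  - intros x x' y [H1 H2]. apply Hfp in H1, H2. destruct H1 as [-> _], H2 as [-> _]. auto.
  - intros y Hy. exists y. apply Hfp. rewrite <- HL. auto.
  - intros x y j [Hxy Hj]. apply Hfp in Hxy. destruct Hxy as [<- _].
    destruct (K sum_basis T sum_basis_generates HT x j Hj) as [i [Hi Hs]]. exists i. split; auto.
    intros x' y' [Hx' Hf']. apply Hfp in Hf'. destruct Hf' as [<- _]. auto.
  - intros x y i [Hxy Hi]. apply Hfp in Hxy. destruct Hxy as [<- _].
    destruct (K T sum_basis HT sum_basis_generates x i Hi) as [j [Hj Hs]]. exists j. split; auto.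
    intros x' y' [Hx' Hf']. apply Hfp in Hf'. destruct Hf' as [<- _]. auto.
Qed.

Lemma csc_generates (L : sets M) T : (forall z, mem M z L <-> point z) -> arith2 M T -> generates T ->
  exists l, csc (fun z => mem M z L) T (fun x i j m => mem M ⟨⟨x, ⟨i, j⟩⟩, m⟩ l).
Proof.
  intros HL aT [HT HT'].
  set (inter x i j m := T m x /\ forall y, T m y -> T i y /\ T j y).
  (* Taking the least index makes the graph single-valued; some index exists because a piece around
     [x] lies in both basic sets. *)
  set (int x i j m := T i x /\ inter x i j m /\ forall m', inter x i j m' -> m <= m').
  destruct (@comprehension1 (fun p => exists x i j m, p = ⟨⟨x, ⟨i, j⟩⟩, m⟩ /\ int x i j m)) as [l Hl].
  { unfold int, inter. arith. }
  assert (E : forall x i j m, mem M ⟨⟨x, ⟨i, j⟩⟩, m⟩ l <-> int x i j m).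
  { intros x i j m. rewrite Hl. split; [|eauto 6]. intros [x' [i' [j' [m' [E H]]]]].
    apply pair_inj in E. destruct E as [E ->]. apply pair_inj in E. destruct E as [-> E].
    apply pair_inj in E. destruct E as [-> ->]. exact H. }
  exists l. repeat split.
  - intros i x H. apply HL, (HT i x H).
  - intros x Hx. apply HL in Hx. destruct (HT' x 0 Hx) as [i [Hi _]]. eauto.
  - intros x i j m H. apply E in H. apply HL, (HT i x), (proj1 H).
  - intros x i j m n [H1 H2]. apply E in H1, H2. destruct H1 as [_ [H1 H1']], H2 as [_ [H2 H2']].
    apply le_antisym; auto.
  - intros x i j [Hi Hj]. destruct (HT i x Hi) as [Hx [n Hn]], (HT j x Hj) as [_ [n' Hn']].
    destruct (near_both Hn Hn') as [k Hk]. destruct (HT' x k Hx) as [m0 [Hm0 Hs]].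
    destruct (@least (inter x i j) m0) as [m [Hm Hmin]]; [unfold inter; arith | split; auto |].
    exists m. rewrite E. split; [split; auto|]. exact Hm.
Qed.

Theorem sum_is_wellorder : exists L R, wellorder L R /\
  (exists l, csc (fun z => mem M z L) (open_basis L R) (fun x i j m => mem M ⟨⟨x, ⟨i, j⟩⟩, m⟩ l) /\
     homeo point sum_basis (fun z => mem M z L) (open_basis L R)) /\
  (exists l, csc (fun z => mem M z L) (upper_basis L R) (fun x i j m => mem M ⟨⟨x, ⟨i, j⟩⟩, m⟩ l) /\
     homeo point sum_basis (fun z => mem M z L) (upper_basis L R)).
Proof.
  pose proof arith_point. pose proof arith_precedes.
  destruct (comprehension1 arith_point) as [L HL].
  destruct (@comprehension1 (fun p => exists z w, p = ⟨z, w⟩ /\ precedes z w)) as [R HR]; [arith|].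
  pose proof (mem_R_pair HR) as HRp.
  exists L, R. split; [split; [repeat split|]|].
  - intros z Hz. apply HR in Hz. destruct Hz as [x [y [-> K]]]. exists x, y.
    rewrite !HL. split; auto. now apply precedes_point.
  - intros x K. apply HRp in K. exact (precedes_irrefl K).
  - intros x y z. rewrite !HRp. intros [K K']. eapply precedes_trans; eauto.
  - intros x y. rewrite !HL, !HRp. intros [K K']. now apply precedes_total.
  - intros [f [[Hf [Hf' Hf'']] Hd]]. destruct (Hf' 0) as [x0 Hx0].
    destruct (@precedes_wf (fun x => exists n, mem M ⟨n, x⟩ f) x0) as [x [[n Hx] Hmin]].
    + arith.
    + intros x [n Hx]. destruct (Hf _ Hx) as [n' [x' [E K]]]. apply pair_inj in E.
      destruct E as [_ ->]. now apply HL.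
    + eauto.
    + destruct (Hf' (n + 1)) as [y Hy]. pose proof (proj1 (HRp y x) (Hd n x y (conj Hx Hy))) as Hyx.
      destruct (Hmin y) as [->|K]; [eauto | exact (precedes_irrefl Hyx) |].
      exact (precedes_irrefl (precedes_trans K Hyx)).
  - assert (aO : arith2 M (open_basis L R)) by (unfold open_basis; arith).
    assert (aU : arith2 M (upper_basis L R)) by (unfold upper_basis; arith).
    pose proof (open_basis_generates HL HR) as gO. pose proof (upper_basis_generates HL HR) as gU.
    destruct (csc_generates HL aO gO) as [l Hl], (csc_generates HL aU gU) as [l' Hl'].
    split; [exists l | exists l']; split; auto; now apply sum_homeo.
Qed.

End Family.

(** Comprehension turns [Q] into a set of indices. Of the finite subcover only a bound on its
    indices is kept, which is free of set quantifiers and fits [bounding]. *)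
Lemma compact_bounded (pt : D -> Prop) (bs : D -> D -> Prop) (Q : D -> Prop) :
  (forall i x, bs i x -> pt x) -> compact_space pt bs -> arith1 M Q ->
  (forall x, pt x -> exists i, Q i /\ bs i x) ->
  exists n, forall x, pt x -> exists i, i < n /\ Q i /\ bs i x.
Proof.
  intros HB HC HQ Hx. destruct (comprehension1 HQ) as [I HI].
  destruct (HC I) as [A [[n Hn] [HA Hcov]]].
  - intros x. split; [intros Px | intros [i [_ K]]; eauto].
    destruct (Hx x Px) as [i [Qi Hi]]. exists i. rewrite HI. auto.
  - exists n. intros x Px. apply Hcov in Px. destruct Px as [i [Ai Hi]].
    exists i. split; auto. split; auto. now apply HI, HA.
Qed.

Theorem sum_in_model (X U k : sets M) :
  (forall j,
     csc (fun x => mem M ⟨j, x⟩ X) (fun i x => mem M ⟨j, ⟨i, x⟩⟩ U)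
       (fun x i i' m => mem M ⟨j, ⟨⟨x, ⟨i, i'⟩⟩, m⟩⟩ k) /\
     hausdorff (fun x => mem M ⟨j, x⟩ X) (fun i x => mem M ⟨j, ⟨i, x⟩⟩ U) /\
     compact_space (fun x => mem M ⟨j, x⟩ X) (fun i x => mem M ⟨j, ⟨i, x⟩⟩ U)) ->
  let pt := point (fun j x => mem M ⟨j, x⟩ X) in
  let bs := sum_basis (fun j i x => mem M ⟨j, ⟨i, x⟩⟩ U) in
  exists L R, wellorder L R /\
    (exists l, csc (fun z => mem M z L) (open_basis L R) (fun x i j m => mem M ⟨⟨x, ⟨i, j⟩⟩, m⟩ l) /\
       homeo pt bs (fun z => mem M z L) (open_basis L R)) /\
    (exists l, csc (fun z => mem M z L) (upper_basis L R) (fun x i j m => mem M ⟨⟨x, ⟨i, j⟩⟩, m⟩ l) /\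
       homeo pt bs (fun z => mem M z L) (upper_basis L R)).
Proof.
  intros H. apply sum_is_wellorder.
  - arith.
  - arith.
  - intros j. apply H.
  - intros j. apply H.
  - intros j i i' x H1 H2. destruct (H j) as [[_ [_ [_ [_ K]]]] _].
    destruct (K x i i' (conj H1 H2)) as [m [_ Hm]]. eauto.
  - intros j x y H1 H2 N. destruct (H j) as [_ [K _]]. auto.
  - intros j Q HQ. apply compact_bounded; auto; apply H.
Qed.

End Arithmetic.

Theorem corollary7p8 :
  ACA0 ⊢
    ∀² X U k,
      (∀ i, CSC (nth_space X U k i) ∧ T2 (nth_space X U k i) ∧
            compact (nth_space X U k i)) ⇒
      ∃² L R, well_order L R ∧
        (∃² l, CSC (order_topology L R l) ∧
               homeomorphic (disjoint_sum (nth_space X U k)) (order_topology L R l)) ∧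
        (∃² l, CSC (upper_limit_topology L R l) ∧
               homeomorphic (disjoint_sum (nth_space X U k)) (upper_limit_topology L R l)).
Proof.
  apply completeness; [apply ACA0_closed|]. intros M HM e s.
  read_goal. exact (sum_in_model HM (s 0)).
Qed.
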